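(* Let $k_f\in(0,1]$. There exist constants $K,c>0$ such that for all $\nu>0$, all $\gamma\ge K\nu^2$ and all $k_1,k_3\in\mathbb{Z}$, $$\Psi(\mathcal{H}'_{k_1,k_3})\ge c|k_1\gamma|^{1/2}.$$
   Context: $\mathbb{T}_{2\pi}=\mathbb{R}/2\pi\mathbb{Z}$. The operator $$\mathcal{H}'_{k_1,k_3}=-\nu k_f^2\partial_y^2+\frac{ik_1}{k_f^2}\frac{\gamma}{\nu}\sin y$$ acts on $L^2(\mathbb{T}_{2\pi})$ with domain $D(\mathcal{H}'_{k_1,k_3})=H^2(\mathbb{T}_{2\pi})$. For an operator $H$ in a Hilbert space with norm $\|\cdot\|$, $$\Psi(H)=\inf\{\|(H-i\lambda)f\|: f\in D(H),\ \lambda\in\mathbb{R},\ \|f\|=1\};$$ here the norm is the $L^2(\mathbb{T}_{2\pi})$ norm. *)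

(* Defs.v *)
From mathcomp Require Import all_boot all_order all_algebra.
From mathcomp Require Import complex.
From mathcomp Require Import all_classical all_reals all_analysis.

Set Implicit Arguments.
Unset Strict Implicit.
Unset Printing Implicit Defensive.

Import Order.TTheory GRing.Theory Num.Theory.
Import numFieldNormedType.Exports.

Local Open Scope classical_set_scope.
Local Open Scope ring_scope.
Local Open Scope complex_scope.

Section Torus.
Context {R : realType}.

(* Functions on the torus R / 2 pi Z are 2 pi-periodic functions on R, and the
   torus is integrated over one period. Elements of L^2 are represented by
   functions; almost everywhere equal functions stand for the same element. *)
Definition torus : set R := `[0, pi *+ 2]%classic.

Definition torus_integral (u : R -> R[i]) : R[i] :=
  (\int[lebesgue_measure]_(y in torus) complex.Re (u y))%R +i*
  (\int[lebesgue_measure]_(y in torus) complex.Im (u y))%R.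

Definition L2 : set (R -> R[i]) :=
  [set f : R -> R[i] | [/\ periodic f (pi *+ 2),
               measurable_fun setT (fun y : R => complex.Re (f y) : R),
               measurable_fun setT (fun y : R => complex.Im (f y) : R) &
               lebesgue_measure.-integrable torus
                 (fun y => (Normc.normc (f y) ^+ 2)%:E)]].

Definition L2norm (f : R -> R[i]) : R :=
  Num.sqrt (\int[lebesgue_measure]_(y in torus) (Normc.normc (f y) ^+ 2))%R.

(* C^oo real functions on the torus; testing against complex ones would give
   the same weak derivatives, by linearity. *)
Definition test_function (phi : R -> R) : Prop :=
  periodic phi (pi *+ 2) /\
  forall (n : nat) (y : R), derivable (derive1n n phi) y 1.

Definition is_weak_derivative (f g : R -> R[i]) : Prop :=
  forall phi : R -> R, test_function phi ->
    torus_integral (fun y => f y * (derive1 phi y)%:C) =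
    - torus_integral (fun y => g y * (phi y)%:C).

Definition H2 : set (R -> R[i]) :=
  [set f : R -> R[i] | L2 f /\ exists g h : R -> R[i],
     [/\ L2 g, L2 h, is_weak_derivative f g & is_weak_derivative g h]].

(* A representative of the weak derivative in L^2 (unique almost everywhere),
   or 0 if there is none. *)
Definition weak_derivative (f : R -> R[i]) : R -> R[i] :=
  xget (fun=> 0) [set g | L2 g /\ is_weak_derivative f g].

Definition Psi (D : set (R -> R[i])) (H : (R -> R[i]) -> (R -> R[i])) : R :=
  inf [set r | exists (f : R -> R[i]) (lambda : R),
    [/\ D f, L2norm f = 1 &
        r = L2norm (fun y => H f y - 'i * lambda%:C * f y)]].

(* The operator does not depend on k3; the index is kept as in its name. *)
Definition Hprime (kf nu gamma : R) (k1 k3 : int) (f : R -> R[i]) : R -> R[i] :=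
  fun y => - (nu * kf ^+ 2)%:C * weak_derivative (weak_derivative f) y
           + 'i * k1%:~R / (kf ^+ 2)%:C * (gamma / nu)%:C * (sin y)%:C * f y.

End Torus.

(* Main.v *)
Require Import Defs.
From mathcomp Require Import all_boot all_order all_algebra.
From mathcomp Require Import complex.
From mathcomp Require Import all_classical all_reals all_analysis.
From mathcomp Require Import measurable_realfun.
From mathcomp Require Import ring lra.

(** Write [eps = nu kf ^ 2], [a = k1 gamma / (kf ^ 2 nu)] and, for [f] in [H2] of
    norm [1], let [F = - eps f'' + i (a sin y - lambda) f]. The case [k1 = 0] is
    trivial; otherwise one may assume [a > 0] by complex conjugation, and the
    hypothesis on [gamma] implies [eps <= a]. Put [b = lambda / a],
    [s = sin y - b] and let [l <= 1] be the length with [l ^ 4 = eps / a]. The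
    claim is [norm F >= c M] with [M = a l ^ 2 = sqrt (eps a)]. It is proved by
    multipliers:
    - the real part of the product of [F] with [f] gives
      [eps norm(f') ^ 2 <= norm F];
    - the imaginary part of its product with [chi f], where [chi = l ^ 2 s / Q]
      and [Q = s ^ 2 + l ^ 2 (cos ^ 2 + l ^ 2)], controls the integral of
      [M (s ^ 2 / Q) |f| ^ 2], because [chi] is bounded and varies on the scale
      [l] at least;
    - what remains is the mass of [f] near the critical layer [s = 0]. There is
      an explicit bounded periodic function [psi] with
      [1 <= 2 l psi' + 255 s ^ 2 / Q] everywhere ([one_le_weights]), and the
      integral of [psi' |f| ^ 2] is bounded by [norm f'] after an integration by
      parts. This replaces both an estimate of the measure of the critical layer
      and a bound of [f] in the supremum norm.
    All three steps are collected in a single pointwise inequality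
    ([resolvent_density]) whose terms other than [|f| ^ 2] and [|F| ^ 2] are
    densities of null integral; integrating it is [real_resolvent].

    The integrations by parts involve products of functions that have only weak
    derivatives in [L2] ([weak_product_rule]). A weakly differentiable function
    agrees almost everywhere with a primitive of its weak derivative
    ([weak_primitive]); this rests on the du Bois-Reymond lemma
    ([weakly_constant]), whose test functions are antiderivatives of logistic
    functions of trigonometric polynomials, minus their means. For primitives of integrable functions
    the product rule follows from Fubini's theorem ([integral_by_parts],
    [primitiveM]). *)

Import Order.TTheory GRing.Theory Num.Theory.
Import numFieldNormedType.Exports.

Local Open Scope classical_set_scope.
Local Open Scope ring_scope.

(** * Integration by parts for cumulative integrals *)

Section by_parts.
Context {R : realType}.
Notation mu := (@lebesgue_measure R).
Implicit Types p q : R -> R.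

Lemma integral_lower_mask q s :
  \int[mu]_t (q t * (t <= s)%R%:R) = \int[mu]_(t in `]-oo, s]) q t.
Proof.
rewrite [RHS]Rintegral_mkcond; apply: eq_Rintegral => t _.
rewrite patchE mem_setE in_itv/=; case: (t <= s); by rewrite ?mulr1 ?mulr0.
Qed.

Lemma integral_upper_mask p t : mu.-integrable setT (EFin \o p) ->
  \int[mu]_s (p s * (t <= s)%R%:R) =
  \int[mu]_s p s - \int[mu]_(s in `]-oo, t]) p s.
Proof.
move=> ip.
have -> : \int[mu]_s (p s * (t <= s)%R%:R) = \int[mu]_(s in `[t, +oo[) p s.
  rewrite [RHS]Rintegral_mkcond; apply: eq_Rintegral => s _.
  rewrite patchE mem_setE in_itv/= andbT; case: (t <= s); by rewrite ?mulr1 ?mulr0.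
rewrite -set_itvNyy.
rewrite -(@Rintegral_itv_obnd_cbnd _ t)//; last exact: integrableS ip.
rewrite -(@Rintegral_itvB _ _ -oo%O +oo%O t)//.
by apply: integrableS ip.
Qed.

Lemma measurable_le_mask :
  measurable_fun [set: R * R] (fun z : R * R => (z.2 <= z.1)%R%:R : R).
Proof.
have h : measurable_fun [set: R * R] (fun z : R * R => (z.2 <= z.1)%R).
  by apply: measurable_fun_ler; [exact: measurable_snd|exact: measurable_fst].
have -> : (fun z : R * R => (z.2 <= z.1)%R%:R : R) =
          (fun z : R * R => if (z.2 <= z.1)%R then 1 else 0).
  by apply/funext => z; case: ifP.
by apply: measurable_fun_ifT.
Qed.

Lemma integrable_triangle p q :
  mu.-integrable setT (EFin \o p) -> mu.-integrable setT (EFin \o q) ->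
  (mu \x mu)%E.-integrable setT
    (fun z : R * R => (p z.1 * q z.2 * (z.2 <= z.1)%R%:R)%:E).
Proof.
move=> ip iq.
have mp : measurable_fun setT p by apply/measurable_EFinP; exact: measurable_int ip.
have mq : measurable_fun setT q by apply/measurable_EFinP; exact: measurable_int iq.
have mpq : measurable_fun [set: R * R] (fun z : R * R => p z.1 * q z.2).
  apply: measurable_funM; first exact: measurableT_comp measurable_fst.
  exact: measurableT_comp measurable_snd.
have ipq : (mu \x mu)%E.-integrable setT (fun z : R * R => (p z.1 * q z.2)%:E); last first.
  apply: le_integrable ipq => //.
- apply/measurable_EFinP; apply: measurable_funM => //; exact: measurable_le_mask.
- move=> z _; rewrite /= lee_fin normrM ler_piMr//.
  by case: (z.2 <= z.1); rewrite ?normr1 ?normr0.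
apply/integrable12ltyP; first exact/measurable_EFinP.
have [_ ip'] := integrableP _ _ _ ip; have [_ iq'] := integrableP _ _ _ iq.
have fq : (\int[mu]_y `|(q y)%:E| \is a fin_num)%E.
  by rewrite ge0_fin_numE//; apply: integral_ge0.
apply: (@le_lt_trans _ _ (\int[mu]_x ((fine (\int[mu]_y `|(q y)%:E|))%:E * `|(p x)%:E|))%E); last first.
  rewrite ge0_integralZl//; last 2 first.
  - by apply/measurable_EFinP/measurableT_comp.
  - by rewrite lee_fin fine_ge0// integral_ge0.
  by rewrite lte_mul_pinfty// lee_fin fine_ge0// integral_ge0.
rewrite le_eqVlt; apply/orP; left; apply/eqP; apply: eq_integral => x _; rewrite fineK// muleC -ge0_integralZl//.
  by apply: eq_integral => y _ /=; rewrite normrM.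
by apply/measurable_EFinP/measurableT_comp.
Qed.

Lemma triangle_slice p q s :
  mu.-integrable setT (EFin \o q) ->
  (\int[mu]_t (p s * q t * (t <= s)%R%:R)%:E)%E =
  (p s * \int[mu]_(t in `]-oo, s]) q t)%:E.
Proof.
move=> iq.
have imq : mu.-integrable setT (fun t => (q t * (t <= s)%R%:R)%:E).
  apply: le_integrable (iq) => //.
    apply/measurable_EFinP; apply: measurable_funM.
      by apply/measurable_EFinP; exact: measurable_int iq.
    rewrite (_ : (fun t : R => _) = fun t => if (t <= s)%R then 1 else 0); last first.
      by apply/funext => t; case: ifP.
    apply: measurable_fun_ifT => //; exact: measurable_fun_ler.
  move=> t _; rewrite /= lee_fin normrM ler_piMr//.
  by case: (t <= s); rewrite ?normr1 ?normr0.
rewrite -integral_lower_mask EFinM /Rintegral fineK; last first.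
  exact: (integrable_fin_num measurableT imq).
rewrite -integralZl//; apply: eq_integral => t _.
by rewrite -EFinM mulrA.
Qed.

Lemma integrable_mul_cumul p q :
  mu.-integrable setT (EFin \o p) -> mu.-integrable setT (EFin \o q) ->
  mu.-integrable setT (EFin \o (fun s => p s * \int[mu]_(t in `]-oo, s]) q t)).
Proof.
move=> ip iq.
apply: eq_integrable (integrable_fubini_F (integrable_triangle _ _ ip iq)) => //.
by move=> s _; rewrite /fubini_F /= triangle_slice.
Qed.

(** Fubini on the half plane [t <= s]. Its slices at fixed [t] are the half lines
    [`[t, +oo[], whence the product of the two total integrals minus the
    cumulative integral of [p]. *)
Lemma integral_by_parts p q :
  mu.-integrable setT (EFin \o p) -> mu.-integrable setT (EFin \o q) ->
  \int[mu]_s (p s * \int[mu]_(t in `]-oo, s]) q t) =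
  \int[mu]_s p s * \int[mu]_t q t -
  \int[mu]_t (\int[mu]_(s in `]-oo, t]) p s * q t).
Proof.
move=> ip iq.
have iE := integrable_triangle _ _ ip iq.
have imp t : mu.-integrable setT (fun s => (p s * (t <= s)%R%:R)%:E).
  apply: le_integrable (ip) => //.
    apply/measurable_EFinP; apply: measurable_funM.
      by apply/measurable_EFinP; exact: measurable_int ip.
    rewrite (_ : (fun s : R => _) = fun s => if (t <= s)%R then 1 else 0); last first.
      by apply/funext => s; case: ifP.
    apply: measurable_fun_ifT => //; exact: measurable_fun_ler.
  move=> s _; rewrite /= lee_fin normrM ler_piMr//.
  by case: (t <= s); rewrite ?normr1 ?normr0.
have e2 t : (\int[mu]_s (p s * q t * (t <= s)%R%:R)%:E)%E =
            ((\int[mu]_s p s) * q t - (\int[mu]_(s in `]-oo, t]) p s) * q t)%:E.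
  rewrite -mulrBl -integral_upper_mask// mulrC EFinM /Rintegral fineK; last first.
    exact: (integrable_fin_num measurableT (imp t)).
  rewrite -integralZl//; apply: eq_integral => s _.
  by rewrite -EFinM mulrA (mulrC (q t)).
have F := Fubini iE.
rewrite /= in F.
have e1' : (fun x => \int[mu]_y (p x * q y * (y <= x)%R%:R)%:E)%E = (fun s => (p s * \int[mu]_(t in `]-oo, s]) q t)%:E).
  by apply/funext => s; exact: triangle_slice.
have e2' : (fun y => \int[mu]_x (p x * q y * (y <= x)%R%:R)%:E)%E = (fun t =>  ((\int[mu]_s p s) * q t - (\int[mu]_(s in `]-oo, t]) p s) * q t)%:E) by apply/funext.
rewrite e1' e2' in F.
have {}F := congr1 fine F.
have iq1 : mu.-integrable setT (EFin \o (fun t => (\int[mu]_s p s) * q t)).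
  apply: eq_integrable (integrableZl measurableT (\int[mu]_s p s) iq) => //.
have iq2 : mu.-integrable setT (EFin \o (fun t => (\int[mu]_(s in `]-oo, t]) p s) * q t)).
  apply: eq_integrable (integrable_mul_cumul q p iq ip) => // t _.
  by rewrite /= mulrC.
apply: (etrans F).
have := RintegralB measurableT iq1 iq2; rewrite RintegralZl// => <-.
Qed.

End by_parts.

(** * Absolutely continuous functions *)

Section primitive.
Context {R : realType}.
Notation mu := (@lebesgue_measure R).
Implicit Types (u v : R -> R) (L x : R).

(** Absolute continuity on [`[0, L]], with [u'] a density of the derivative. *)
Definition primitive L u u' :=
  mu.-integrable `[0, L] (EFin \o u') /\
  forall x, 0 <= x <= L -> u x = u 0 + \int[mu]_(t in `[0, x]) u' t.

Lemma cumul_patch v x s : 0 <= s <= x ->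
  \int[mu]_(t in `]-oo, s]) (v \_ `[0, x]) t = \int[mu]_(t in `[0, s]) v t.
Proof.
move=> /andP[s0 sx]; rewrite -Rintegral_mkcondr; congr Rintegral.
apply/seteqP; split=> t /=; rewrite !in_itv/=.
  by move=> [ts /andP[-> _]]; rewrite ts.
by move=> /andP[t0 ts]; split=> //; rewrite t0 (le_trans ts).
Qed.

(** Subtracting the values at [0] turns [u] and [v] into the cumulative integrals
    of [u'] and [v'] cut off to [`[0, x]], to which integration by parts on the
    whole line applies. *)
Lemma primitive_by_parts L u u' v v' x : 0 <= x <= L ->
  primitive L u u' -> primitive L v v' ->
  mu.-integrable `[0, x] (fun t => (u' t * (v t - v 0))%:E) /\
  \int[mu]_(t in `[0, x]) (u' t * (v t - v 0)) =
  (u x - u 0) * (v x - v 0) - \int[mu]_(t in `[0, x]) ((u t - u 0) * v' t).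
Proof.
move=> x0L [iu hu] [iv hv].
have [x0 xL] := andP x0L.
have sub : (`[0, x] `<=` `[0, L])%classic by apply: subset_itvl; rewrite bnd_simp.
have ip (w : R -> R) : mu.-integrable `[0, L] (EFin \o w) ->
    mu.-integrable setT (EFin \o (w \_ `[0, x])).
  move=> iw; rewrite -restrict_EFin; apply: (integrable_mkcond _ _).1 => //.
  by apply: integrableS iw.
have cum (w w' : R -> R) t : (forall x, 0 <= x <= L -> w x = w 0 + \int[mu]_(t in `[0, x]) w' t) -> 0 <= t <= x ->
    \int[mu]_(t in `]-oo, t]) (w' \_ `[0, x]) t = w t - w 0.
  move=> hw tx; rewrite cumul_patch//.
  have /andP[t0 t1] := tx.
  by rewrite (hw t) ?t0 ?(le_trans t1)// addrC addKr.
have e1 : (fun s => (u' \_ `[0, x]) s * \int[mu]_(t in `]-oo, s]) (v' \_ `[0, x]) t)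
   = (fun s => u' s * (v s - v 0)) \_ `[0, x].
  apply/funext => s; rewrite !patchE; case: ifPn => [|_]; last by rewrite mul0r.
  by rewrite mem_setE in_itv/= => sx; rewrite (cum v).
have e2 : (fun s => \int[mu]_(t in `]-oo, s]) (u' \_ `[0, x]) t * (v' \_ `[0, x]) s)
   = (fun s => (u s - u 0) * v' s) \_ `[0, x].
  apply/funext => s; rewrite !patchE; case: ifPn => [|_]; last by rewrite mulr0.
  by rewrite mem_setE in_itv/= => sx; rewrite (cum u).
split.
  have := integrable_mul_cumul _ _ (ip _ iu) (ip _ iv).
  by rewrite e1 -restrict_EFin; apply: (integrable_mkcond _ _).2.
have := integral_by_parts _ _ (ip _ iu) (ip _ iv).
by rewrite e1 e2 -!Rintegral_mkcond (hu x)// (hv x)// ![_ 0 + _]addrC !addrK.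
Qed.

(** The product rule for absolutely continuous functions. It can be iterated, so
    it also covers products of three of them. *)
Lemma primitiveM L u u' v v' : 0 <= L ->
  primitive L u u' -> primitive L v v' ->
  primitive L (fun x => u x * v x) (fun x => u' x * v x + u x * v' x).
Proof.
move=> L0 pu pv; have [iu hu] := pu; have [iv hv] := pv.
have sub x : x <= L -> (`[0, x] `<=` `[0, L])%classic.
  by move=> xL; apply: subset_itvl; rewrite bnd_simp.
have intS (w : R -> R) x : x <= L -> mu.-integrable `[0, L] (EFin \o w) ->
    mu.-integrable `[0, x] (EFin \o w).
  by move=> xL iw; apply: integrableS iw => //; exact: sub.
have i1 x : 0 <= x <= L -> mu.-integrable `[0, x] (EFin \o (fun t => u' t * v t)).
  move=> x0L; have /andP[x0 xL] := x0L.
  have [i _] := primitive_by_parts _ _ _ _ _ _ x0L pu pv.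
  apply: eq_integrable (integrableD _ i (integrableZl _ (v 0) (intS _ _ xL iu))) => //.
  by move=> t _ /=; rewrite -EFinD; congr EFin; ring.
have i2 x : 0 <= x <= L -> mu.-integrable `[0, x] (EFin \o (fun t => u t * v' t)).
  move=> x0L; have /andP[x0 xL] := x0L.
  have [i _] := primitive_by_parts _ _ _ _ _ _ x0L pv pu.
  apply: eq_integrable (integrableD _ i (integrableZl _ (u 0) (intS _ _ xL iv))) => //.
  by move=> t _ /=; rewrite -EFinD; congr EFin; ring.
have LL : 0 <= L <= L by rewrite L0 lexx.
split.
  by apply: eq_integrable (integrableD _ (i1 _ LL) (i2 _ LL)).
move=> x x0L; have /andP[x0 xL] := x0L.
rewrite RintegralD//; [|exact: i1|exact: i2].
have [i3 e] := primitive_by_parts _ _ _ _ _ _ x0L pu pv.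
move: e; under eq_Rintegral do rewrite mulrBr.
rewrite RintegralB//; [|exact: i1|]; last first.
  by apply: eq_integrable (integrableZl _ (v 0) (intS _ _ xL iu)) => // t _ /=; rewrite mulrC.
rewrite RintegralZr//; last exact: intS iu.
under [X in _ = _ - X]eq_Rintegral do rewrite mulrBl.
rewrite RintegralB//; [|exact: i2|]; last first.
  by apply: eq_integrable (integrableZl _ (u 0) (intS _ _ xL iv)).
rewrite RintegralZl//; last exact: intS iv.
have -> : \int[mu]_(t in `[0, x]) u' t = u x - u 0 by rewrite (hu x)// addrC addKr.
have -> : \int[mu]_(t in `[0, x]) v' t = v x - v 0 by rewrite (hv x)// addrC addKr.
move=> e; apply: (@addIr _ (- (u x - u 0) * v 0)).
rewrite mulNr [_ + _ - _]addrAC.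
set I1 := Rintegral _ _ _ in e *; set I2 := Rintegral _ _ _ in e *.
suff : I1 = (u x - u 0) * v 0 + ((u x - u 0) * (v x - v 0) - (I2 - u 0 * (v x - v 0))).
  by move=> ->; ring.
by rewrite -e; ring.
Qed.

Lemma primitive_C1 L (f f' : R -> R) : 0 < L ->
  (forall x, is_derive x 1 f (f' x)) -> continuous f' -> primitive L f f'.
Proof.
move=> L0 df cf'.
have cw a b : {within `[a, b], continuous f'} by apply: continuous_subspaceT.
have ci a b : mu.-integrable `[a, b] (EFin \o f').
  by apply: continuous_compact_integrable => //; exact: segment_compact.
split=> // x /andP[]; rewrite le_eqVlt => /predU1P[<- _|x0 xL].
  by rewrite set_itv1 Rintegral_set1 addr0.
have dc y : {for y, continuous f}.
  by apply: differentiable_continuous; apply/derivable1_diffP; have [] := df y.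
rewrite /Rintegral (@continuous_FTC2 _ _ f)//.
- by rewrite -EFinB /= addrC subrK.
- split=> [y _||]; first by have [] := df y.
  + by apply: cvg_at_right_filter; exact: dc.
  + by apply: cvg_at_left_filter; exact: dc.
by move=> y _; rewrite derive1E; have [_ ->] := df y.
Qed.

End primitive.

(** * Smooth trigonometric algebras and antiderivatives *)

Section smooth.
Context {R : realType}.
Notation mu := (@lebesgue_measure R).
Implicit Types (f g tau : R -> R).

Lemma deriv1D f g (x a b : R) : is_derive x 1 f a -> is_derive x 1 g b ->
  is_derive x 1 (fun y => f y + g y) (a + b).
Proof. exact: is_deriveD. Qed.

Lemma deriv1M f g (x a b : R) : is_derive x 1 f a -> is_derive x 1 g b ->
  is_derive x 1 (fun y => f y * g y) (a * g x + f x * b).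
Proof.
move=> fa gb; have := is_deriveM fa gb.
by rewrite (_ : f x *: b + g x *: a = a * g x + f x * b)// addrC mulrC.
Qed.

Lemma deriv1V f (x a : R) : f x != 0 -> is_derive x 1 f a ->
  is_derive x 1 (fun y => (f y)^-1) (- a * (f x)^-1 ^+ 2).
Proof.
move=> fx0 fa; have := is_deriveV fx0 fa.
by rewrite -[_ *: _]/(_ * _) exprVn mulNr mulrC mulNr.
Qed.

Lemma deriv1_continuous f f' : (forall x : R, is_derive x 1 f (f' x)) ->
  continuous f.
Proof.
move=> df y; apply: differentiable_continuous; apply/derivable1_diffP.
by have [] := df y.
Qed.

Lemma deriv1_derive1 f f' : (forall x : R, is_derive x 1 f (f' x)) ->
  derive1 f = f'.
Proof. by move=> df; apply/funext => x; rewrite derive1E; have [_ ->] := df x. Qed.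

(** An algebra of functions that is stable under differentiation as soon as it
    contains the derivative of [tau]; its elements are then smooth, and no higher
    derivative has to be computed. *)
Inductive trig_alg tau : (R -> R) -> Prop :=
| trig_alg_cst c : trig_alg tau (fun=> c)
| trig_alg_cos : trig_alg tau cos
| trig_alg_sin : trig_alg tau sin
| trig_alg_gen : trig_alg tau tau
| trig_alg_add f g : trig_alg tau f -> trig_alg tau g ->
    trig_alg tau (fun x => f x + g x)
| trig_alg_mul f g : trig_alg tau f -> trig_alg tau g ->
    trig_alg tau (fun x => f x * g x).

Lemma trig_alg_deriv tau tau' f : trig_alg tau tau' ->
  (forall x : R, is_derive x 1 tau (tau' x)) -> trig_alg tau f ->
  exists2 f', trig_alg tau f' & forall x : R, is_derive x 1 f (f' x).
Proof.
move=> at' dt; elim.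
- move=> c; exists (fun=> 0); first exact: trig_alg_cst.
  by move=> x; exact: is_derive_cst.
- exists (fun x => -1 * sin x); last by move=> x; rewrite mulN1r; exact: is_derive_cos.
  by apply: trig_alg_mul; [exact: trig_alg_cst|exact: trig_alg_sin].
- by exists cos; [exact: trig_alg_cos|move=> x; exact: is_derive_sin].
- by exists tau'.
- move=> {}f g _ [f' af' df] _ [g' ag' dg].
  exists (fun x => f' x + g' x); first exact: trig_alg_add.
  by move=> x; exact: deriv1D.
- move=> {}f g af [f' af' df] ag [g' ag' dg].
  exists (fun x => f' x * g x + f x * g' x).
    by apply: trig_alg_add; exact: trig_alg_mul.
  by move=> x; exact: deriv1M.
Qed.

Lemma trig_alg_smooth tau tau' f : trig_alg tau tau' ->
  (forall x : R, is_derive x 1 tau (tau' x)) -> trig_alg tau f ->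
  forall n (x : R), derivable (derive1n n f) x 1.
Proof.
move=> at' dt af n; elim: n f af => [|n IH] f af x.
  by have [f' _ df] := trig_alg_deriv _ _ _ at' dt af; have [] := df x.
have [f' af' df] := trig_alg_deriv _ _ _ at' dt af.
rewrite /derive1n iterSr -/(derive1n n _) (deriv1_derive1 _ _ df).
exact: IH.
Qed.

Lemma trig_alg_periodic tau f : periodic tau (pi *+ 2) -> trig_alg tau f ->
  periodic f (pi *+ 2).
Proof.
move=> pt; elim=> // [||{}f g _ pf _ pg x|{}f g _ pf _ pg x].
- exact: cosD2pi.
- exact: sinD2pi.
- by rewrite pf pg.
- by rewrite pf pg.
Qed.

Lemma continuous_integrable_itv f (a b : R) : continuous f ->
  mu.-integrable `[a, b] (EFin \o f).
Proof.
move=> cf; apply: continuous_compact_integrable; first exact: segment_compact.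
exact: continuous_subspaceT.
Qed.

Lemma Rintegral_itvD f (a b c : R) : continuous f -> a <= b -> b <= c ->
  \int[mu]_(t in `[a, c]) f t =
  \int[mu]_(t in `[a, b]) f t + \int[mu]_(t in `[b, c]) f t.
Proof.
move=> cf ab bc.
have := @Rintegral_itvB _ f (BLeft a) (BRight c) b (continuous_integrable_itv _ _ _ cf).
rewrite !bnd_simp => /(_ ab bc) e.
rewrite -(@Rintegral_itv_obnd_cbnd _ b (BRight c)) -?e 1?addrC ?subrK//.
apply: integrableS (continuous_integrable_itv f b c cf) => //.
by apply: subset_itvr; rewrite bnd_simp.
Qed.

(** The integral from a base point is an antiderivative only to the right of that
    point, so the base point [- `|x| - 1] moves with [x]; normalizing at [0] makes
    the result independent of the base point. *)
Lemma antiderivative f : continuous f ->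
  exists F : R -> R, forall x : R, is_derive x 1 F (f x).
Proof.
move=> cf; pose G a x := \int[mu]_(t in `[a, x]) f t.
pose F x := G (- `|x| - 1) x - G (- `|x| - 1) 0.
have Gindep a b x : a <= b -> b <= x -> b <= 0 -> G a x - G a 0 = G b x - G b 0.
  move=> ab bx b0; rewrite /G (@Rintegral_itvD f a b x)// (@Rintegral_itvD f a b 0)//.
  ring.
have FE a x : a <= x -> a <= 0 -> F x = G a x - G a 0.
  move=> ax a0; have x0 := normr_ge0 x; have hx := ler_norm (- x).
  rewrite normrN in hx.
  have [h|/ltW h] := leP a (- `|x| - 1).
    by rewrite (@Gindep a (- `|x| - 1) x)//; lra.
  by rewrite /F (@Gindep _ a x).
exists F => x; have x0 := normr_ge0 x; have hx := ler_norm (- x).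
rewrite normrN in hx.
pose a := - `|x| - 1.
have [dG eG] : derivable (G a) x 1 /\ derive1 (G a) x = f x.
  apply: (@continuous_FTC1_closed _ f a x (x + 1)); rewrite ?ltrDl//.
  - exact: continuous_integrable_itv.
  - by rewrite /a; lra.
  - exact: cf.
have {eG}dG : is_derive x 1 (G a) (f x) by apply: DeriveDef => //; rewrite -derive1E.
have := deriv1D _ _ _ _ _ dG (is_derive_cst (- G a 0) x 1); rewrite addr0.
apply: near_eq_is_derive; near=> y; rewrite (FE a y)//; last by rewrite /a; lra.
by apply: ltW; near: y; apply: lt_nbhsr; rewrite /a; lra.
Unshelve. all: by end_near. Qed.

End smooth.

(** * The du Bois-Reymond lemma on the torus *)

Section fundamental.
Context {R : realType}.
Notation mu := (@lebesgue_measure R).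
Implicit Types (f g tau w phi psi : R -> R).
Local Notation T := (@torus R).
Local Notation L := (pi *+ 2 : R).

Lemma measurable_torus : measurable (T : set (measurableTypeR R)).
Proof. exact: measurable_itv. Qed.

#[local] Hint Resolve measurable_torus : core.

Lemma period_gt0 : 0 < L.
Proof. by rewrite mulrn_wgt0// pi_gt0. Qed.

Lemma Rintegral_torus_cst (c : R) : \int[mu]_(y in T) c = c * L.
Proof.
have mT : mu T = L%:E.
  have := lebesgue_measure_itv `[0, L]; rewrite /= lte_fin period_gt0 => ->.
  by rewrite oppr0 adde0.
rewrite Rintegral_cst; last exact: measurable_torus.
by rewrite [X in fine X]mT.
Qed.

Lemma integrable_torus_cst (c : R) : mu.-integrable T (fun=> c%:E).
Proof. by apply: (@continuous_integrable_itv _ (fun=> c)) => x; exact: cvg_cst. Qed.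

Lemma integrable_mul_bounded w f (M : R) : mu.-integrable T (EFin \o w) ->
  measurable_fun T f -> (forall x, T x -> `|f x| <= M) ->
  mu.-integrable T (fun x => (w x * f x)%:E).
Proof.
move=> iw mf fM.
have M0 : 0 <= M by apply: le_trans (fM 0 _); rewrite ?normr_ge0// /torus/= in_itv/= lexx ltW// period_gt0.
have iMw := integrableZl measurable_torus M iw.
apply: le_integrable iMw => //.
- apply/measurable_EFinP; apply: measurable_funM => //.
  by apply/measurable_EFinP; exact: measurable_int iw.
- move=> x Tx; rewrite /= lee_fin normrM normrM mulrC ler_wpM2r//.
  by rewrite (ger0_norm M0) fM.
Qed.

(** An antiderivative is periodic exactly when the integral over a period
    vanishes. *)
Lemma test_antiderivative tau tau' psi : periodic tau (pi *+ 2) ->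
  trig_alg tau tau' -> (forall x : R, is_derive x 1 tau (tau' x)) ->
  trig_alg tau psi -> \int[mu]_(y in T) psi y = 0 ->
  exists2 phi, test_function phi & derive1 phi = psi.
Proof.
move=> pt at' dt ap i0.
have [psi' _ dpsi] := trig_alg_deriv _ _ _ at' dt ap.
have cpsi := deriv1_continuous _ _ dpsi.
have [phi dphi] := antiderivative _ cpsi.
exists phi; last exact: deriv1_derive1.
split; last first.
  case=> [|n] y; first by have [] := dphi y.
  rewrite /derive1n iterSr -/(derive1n n _) (deriv1_derive1 _ _ dphi).
  exact: trig_alg_smooth at' dt ap n y.
have ppsi := trig_alg_periodic _ _ pt ap.
have dL (x : R) : is_derive x 1 (fun y => phi (y + L)) (psi x).
  rewrite -ppsi.
  have := @is_derive1_comp _ phi (fun y => y + L) x (psi (x + L)) 1 (dphi _).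
  rewrite mulr1; apply.
  by have := deriv1D _ _ _ _ _ (is_derive_id x 1) (is_derive_cst L x 1); rewrite addr0.
have d0 (x : R) : is_derive x 1 (fun y => phi (y + L) + -1 * phi y) 0.
  have dN := deriv1M _ _ _ _ _ (is_derive_cst (-1 : R) x 1) (dphi x).
  have := deriv1D _ _ _ _ _ (dL x) dN.
  by rewrite (_ : psi x + _ = 0)// /cst; ring.
move=> x; have := @is_derive_0_is_cst _ _ x 0 d0.
have [_ /(_ L)] := primitive_C1 _ _ _ period_gt0 dphi cpsi.
rewrite lexx (ltW period_gt0) => /(_ isT); rewrite i0 addr0 add0r => ->.
by rewrite !mulN1r subrr => /eqP; rewrite subr_eq0 => /eqP.
Qed.

(** A smooth approximation of the indicator of [0 < s]: the logistic function of
    [N ^ 2 s - N]. The shift by [N] makes it tend to [0], and not to [1 / 2], at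
    [s = 0]. *)
Definition smooth_step (N : nat) (s : R) : R :=
  (1 + expR (N%:R - N%:R ^+ 2 * s))^-1.

Lemma smooth_step_bounds N s : 0 <= smooth_step N s <= 1.
Proof.
have e0 := expR_gt0 (N%:R - N%:R ^+ 2 * s : R).
by rewrite /smooth_step invr_ge0 invf_le1 ?andbT; lra.
Qed.

Lemma smooth_step_cvg s : smooth_step ^~ s @ \oo --> ((0 < s)%R%:R : R).
Proof.
have h0 : @harmonic R @ \oo --> (0 : R) by exact: cvg_harmonic.
have [s0|s0] := ltP 0 s.
- apply: (@squeeze_cvgr _ _ _ _ (fun n => 1 - harmonic n) (cst 1)).
  + near=> N.
    have [_ ->] := andP (smooth_step_bounds N s); rewrite andbT.
    have hN : 2 <= N%:R * s.
      rewrite -ler_pdivrMr//; near: N; exact: nbhs_infty_ger.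
    have N0 : 0 <= N%:R :> R by [].
    have e1 : expR (N%:R - N%:R ^+ 2 * s) <= harmonic N.
      apply: (@le_trans _ _ (expR (- N%:R))).
        by rewrite ler_expR expr2; nra.
      rewrite expRN /harmonic lef_pV2 ?posrE ?expR_gt0//.
      by rewrite -natr1 addrC expR_ge1Dx.
    have e0 := expR_gt0 (N%:R - N%:R ^+ 2 * s : R).
    rewrite /smooth_step; set e := expR _ in e0 e1 *.
    rewrite -[leRHS]mul1r ler_pdivlMr; last lra.
    have : 0 <= @harmonic R N by rewrite /harmonic invr_ge0.
    nra.
  + by rewrite -[X in _ --> X]subr0; apply: cvgB => //; exact: cvg_cst.
  + exact: cvg_cst.
- apply: (@squeeze_cvgr _ _ _ _ (cst 0) harmonic) => //; last exact: cvg_cst.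
  near=> N; have [-> _] := andP (smooth_step_bounds N s); rewrite /=.
  rewrite /smooth_step /harmonic lef_pV2 ?posrE ?addr_gt0 ?expR_gt0//.
  rewrite -natr1 addrC lerD2l (le_trans _ (expR_ge1Dx _))//.
  have N0 : 0 <= N%:R ^+ 2 :> R by rewrite exprn_ge0.
  nra.
Unshelve. all: by end_near. Qed.

(** Equal to [2 sin (y / 2) sin ((x - y) / 2)]: a smooth periodic function that is
    positive, within the period [`[0, 2 pi]] and for [0 < x < 2 pi], exactly on
    [`]0, x[]. *)
Definition arc (x y : R) : R := cos (y - x / 2) - cos (x / 2).

Lemma arc_gt0 x y : 0 < x < L -> 0 <= y <= L -> (0 < arc x y) = (0 < y < x).
Proof.
move=> /andP[x0 xL] /andP[y0 yL].
have -> : arc x y = 2 * (sin (y / 2) * sin ((x - y) / 2)).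
  rewrite /arc; have -> : y - x / 2 = y / 2 - (x - y) / 2 by field.
  have -> : x / 2 = y / 2 + (x - y) / 2 by field.
  by rewrite cosB cosD; ring.
have pi0 := pi_gt0 R.
move: y0; rewrite le_eqVlt => /predU1P[<-|y0].
  by rewrite mul0r sin0 mul0r mulr0 ltxx.
move: yL; rewrite le_eqVlt => /predU1P[->|yL].
  have -> : pi *+ 2 / 2 = pi :> R by rewrite mulr2n; field.
  by rewrite sinpi mul0r mulr0 ltxx (ltNge L) (ltW xL) andbF.
have sy : 0 < sin (y / 2) by apply: sin_gt0_pi; move: yL; rewrite mulr2n; lra.
rewrite y0 /= pmulr_rgt0// pmulr_rgt0//.
have [yx|xy] := ltP y x.
  by apply: sin_gt0_pi; move: xL; rewrite mulr2n; lra.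
apply/negbTE; rewrite -leNgt.
have -> : (x - y) / 2 = - ((y - x) / 2) by field.
by rewrite sinN oppr_le0 sin_ge0_pi//; move: yL; rewrite mulr2n; lra.
Qed.

Lemma deriv_arc x (y : R) :
  is_derive y 1 (arc x) (sin (x / 2) * cos y + - cos (x / 2) * sin y).
Proof.
have -> : arc x = (fun y => (cos (x / 2) * cos y + sin (x / 2) * sin y) + - cos (x / 2)).
  by apply/funext => z; rewrite /arc cosB; ring.
have d1 := deriv1M _ _ _ _ _ (is_derive_cst (cos (x / 2)) y 1) (is_derive_cos y).
have d2 := deriv1M _ _ _ _ _ (is_derive_cst (sin (x / 2)) y 1) (is_derive_sin y).
have := deriv1D _ _ _ _ _ (deriv1D _ _ _ _ _ d1 d2) (is_derive_cst (- cos (x / 2)) y 1).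
rewrite (_ : _ + _ + 0 = sin (x / 2) * cos y + - cos (x / 2) * sin y)//.
by rewrite /cst; ring.
Qed.

(** Derivative of [smooth_step N (arc x y)], written with the identity
    [sigma' = sigma (1 - sigma)] of the logistic function so that it visibly lies
    in the algebra generated by the step. *)
Definition step_slope (N : nat) x (y : R) : R := N%:R ^+ 2 *
  (sin (x / 2) * cos y + - cos (x / 2) * sin y) *
  (smooth_step N (arc x y) * (1 + -1 * smooth_step N (arc x y))).

Lemma step_slope_alg N x :
  trig_alg (fun y => smooth_step N (arc x y)) (step_slope N x).
Proof.
by do ?[apply: trig_alg_mul|apply: trig_alg_add|exact: trig_alg_cst
  |exact: trig_alg_sin|exact: trig_alg_cos|exact: trig_alg_gen].
Qed.

Lemma deriv_step N x (y : R) :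
  is_derive y 1 (fun y => smooth_step N (arc x y)) (step_slope N x y).
Proof.
pose e z : R := N%:R + - N%:R ^+ 2 * arc x z.
have de : is_derive y 1 e
    (- N%:R ^+ 2 * (sin (x / 2) * cos y + - cos (x / 2) * sin y)).
  have d1 := deriv1M _ _ _ _ _ (is_derive_cst (- N%:R ^+ 2 : R) y 1) (deriv_arc x y).
  have := deriv1D _ _ _ _ _ (is_derive_cst (N%:R : R) y 1) d1.
  by rewrite mul0r !add0r.
have dE := is_derive1_comp (is_derive_expR (e y)) de.
have dd : is_derive y 1 (fun z => 1 + expR (e z))
    (0 + expR (e y) * (- N%:R ^+ 2 * (sin (x / 2) * cos y + - cos (x / 2) * sin y))).
  exact: deriv1D (is_derive_cst (1 : R) y 1) dE.
have ne0 : 1 + expR (e y) != 0 by rewrite gt_eqF// addr_gt0// expR_gt0.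
have := deriv1V (fun z => 1 + expR (e z)) y _ ne0 dd.
have -> : (fun z => (1 + expR (e z))^-1) = (fun z => smooth_step N (arc x z)).
  by apply/funext => z; rewrite /smooth_step /e mulNr.
rewrite (_ : _ * _ ^+ 2 = step_slope N x y)//.
have ey : N%:R - N%:R ^+ 2 * arc x y = e y by rewrite /e mulNr.
rewrite /step_slope /smooth_step ey.
by field.
Qed.

Lemma step_periodic N x : periodic (fun y => smooth_step N (arc x y)) L.
Proof. by move=> y; rewrite /arc addrAC cosD2pi. Qed.

Lemma measurable_step N x (D : set R) :
  measurable_fun D (fun y => smooth_step N (arc x y)).
Proof.
apply: (@measurable_funS _ _ _ _ setT) => //; apply: continuous_measurable_fun.
exact: deriv1_continuous (deriv_step N x).
Qed.

(** The step minus its mean is the derivative of a test function. *)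
Lemma mean_free_step w N x : mu.-integrable T (EFin \o w) ->
  (forall phi, test_function phi -> \int[mu]_(y in T) (w y * derive1 phi y) = 0) ->
  \int[mu]_(y in T) ((w y - (\int[mu]_(y in T) w y) / L) * smooth_step N (arc x y)) = 0.
Proof.
move=> iw hw; set I := \int[mu]_(y in T) w y.
pose tau y := smooth_step N (arc x y).
have ctau : continuous tau := deriv1_continuous _ _ (deriv_step N x).
have itau : mu.-integrable T (EFin \o tau) by exact: continuous_integrable_itv.
set J := \int[mu]_(y in T) tau y.
have L0 : L != 0 by rewrite gt_eqF// period_gt0.
have i0 : \int[mu]_(y in T) (tau y + - (J / L)) = 0.
  rewrite RintegralD//; last exact: integrable_torus_cst.
  by rewrite Rintegral_torus_cst -/J mulNr divfK// subrr.
have [phi tphi ephi] := test_antiderivative _ _ _ (step_periodic N x)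
  (step_slope_alg N x) (deriv_step N x)
  (trig_alg_add _ _ _ (trig_alg_gen _) (trig_alg_cst _ _)) i0.
have := hw _ tphi; rewrite ephi.
have iwt : mu.-integrable T (EFin \o (fun y => w y * tau y)).
  apply: (integrable_mul_bounded w tau 1) => //; first exact: measurable_step.
  move=> y _; have /andP[h0 h1] := smooth_step_bounds N (arc x y).
  by rewrite ger0_norm.
under eq_Rintegral do rewrite mulrDr.
rewrite RintegralD//; last first.
  apply: eq_integrable (integrableZl _ (- (J / L)) iw) => // y _ /=.
  by rewrite -EFinM mulrC.
rewrite RintegralZr// -/I => e.
under eq_Rintegral do rewrite mulrBl.
rewrite RintegralB//; last by apply: (integrableZl _ (I / L) itau).
by rewrite RintegralZl// -/J -[RHS]e mulrN mulrA mulrAC.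
Qed.

(** Dominated convergence, as the smooth steps tend to the indicator of
    [`]0, x[]. *)
Lemma mean_free_arc w x : 0 < x < L -> mu.-integrable T (EFin \o w) ->
  (forall N, \int[mu]_(y in T) (w y * smooth_step N (arc x y)) = 0) ->
  \int[mu]_(y in `[0, x]) w y = 0.
Proof.
move=> x0L iw h0; have /andP[x0 xL] := x0L.
have mw : measurable_fun T w by apply/measurable_EFinP; exact: measurable_int iw.
have sub : (`]0, x[ `<=` T)%classic.
  by move=> y /=; rewrite /torus/= !in_itv/= => /andP[y0 yx]; rewrite !ltW// (lt_trans yx).
have isub (D : set R) : measurable (D : set (measurableTypeR R)) -> (D `<=` T)%classic ->
    mu.-integrable D (EFin \o w).
  by move=> mD DT; apply: integrableS iw.
pose F N y := (w y * smooth_step N (arc x y))%:E.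
have iF N : mu.-integrable T (F N).
  apply: (integrable_mul_bounded w _ 1) => //; first exact: measurable_step.
  move=> y _; have /andP[? ?] := smooth_step_bounds N (arc x y).
  by rewrite ger0_norm.
pose G y := (w y * (0 < y < x)%R%:R)%:E.
have FG y : T y -> F ^~ y @ \oo --> G y.
  rewrite /T/= in_itv/= => yT; apply/cvg_EFin; first by apply: nearW.
  apply: cvgM; first exact: cvg_cst.
  by rewrite -arc_gt0//; exact: smooth_step_cvg.
have GE : G = ((EFin \o w) \_ `]0, x[).
  apply/funext => y; rewrite /G patchE mem_setE in_itv/=.
  by case: (0 < y < x); rewrite ?mulr1 ?mulr0.
have mG : measurable_fun T G.
  have subTx : (T `&` `]0, x[ `<=` T)%classic by move=> y [].
  have mEw : measurable_fun T (EFin \o w) by exact: measurable_int iw.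
  rewrite GE; apply: (measurable_restrict _ _ _).1; [exact: measurable_itv..|].
  by apply: (measurable_funS _ subTx mEw); exact: measurable_itv.
have := @dominated_convergence _ _ _ mu T measurable_torus F G
  (fun y => `|w y|%:E) (fun N => measurable_int _ (iF N)) mG.
case.
- by apply: aeW => y; exact: FG.
- exact: integrable_norm.
- apply: aeW => y N Ty; rewrite /F /= lee_fin normrM ler_piMr//.
  have /andP[? ?] := smooth_step_bounds N (arc x y).
  by rewrite ger0_norm.
move=> iG _ cG.
have eF N : (\int[mu]_(y in T) F N y)%E = 0%E.
  rewrite -(fineK (integrable_fin_num measurable_torus (iF N))).
  by congr EFin; exact: h0.
have eG : (\int[mu]_(y in T) G y)%E = 0%E.
  have : [sequence (\int[mu]_(y in T) F N y)%E]_N @ \oo --> 0%E.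
    by under eq_fun do rewrite eF; exact: cvg_cst.
  move=> /(cvg_lim (@ereal_hausdorff R)) <-.
  exact/esym/(cvg_lim (@ereal_hausdorff R)).
rewrite -Rintegral_itv_obnd_cbnd -?Rintegral_itv_bndo_bndc.
- rewrite /Rintegral -(setIidr sub) integral_mkcondr.
  by move: eG; rewrite GE => ->.
- exact: isub.
- apply: isub => // y /=; rewrite /torus/= !in_itv/= => /andP[y0 yx].
  by rewrite ltW// (le_trans yx)// ltW.
Qed.

(** The du Bois-Reymond lemma. Smooth steps minus their means are derivatives of
    test functions, so [w] minus its mean integrates to zero over every
    [`[0, x]]; by Lebesgue differentiation it vanishes almost everywhere. *)
Lemma weakly_constant w : mu.-integrable T (EFin \o w) ->
  (forall phi, test_function phi -> \int[mu]_(y in T) (w y * derive1 phi y) = 0) ->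
  {ae mu, forall y, T y -> w y = (\int[mu]_(y in T) w y) / L}.
Proof.
move=> iw hw; set m := _ / L.
pose W y := w y - m.
have iW : mu.-integrable T (EFin \o W).
  have := integrableB measurable_torus iw (integrable_torus_cst m).
  by apply: eq_integrable => // y _.
have L0 : L != 0 by rewrite gt_eqF// period_gt0.
have W0 x : 0 <= x <= L -> \int[mu]_(y in `[0, x]) W y = 0.
  move=> /andP[]; rewrite le_eqVlt => /predU1P[<- _|x0].
    by rewrite set_itv1 Rintegral_set1.
  rewrite le_eqVlt => /predU1P[->|xL].
    rewrite RintegralB//; last exact: integrable_torus_cst.
    by rewrite [X in _ - X]Rintegral_torus_cst /m divfK// subrr.
  apply: mean_free_arc; rewrite ?x0//.
  by move=> N; exact: mean_free_step.
pose V := W \_ T.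
have iV : mu.-integrable setT (EFin \o V).
  by rewrite -restrict_EFin; apply: (integrable_mkcond _ _).1 => //; exact: measurable_torus.
have F0 x : \int[mu]_(t in `]-oo, x]) V t = 0.
  have [x0|x0] := ltP x 0.
    rewrite (@eq_Rintegral _ _ _ _ _ (cst 0)).
      by rewrite Rintegral_cst// mul0r.
    move=> y; rewrite inE/= in_itv/= => yx; rewrite /V patchE memNset//.
    by rewrite /torus/= in_itv/= => /andP[/le_lt_trans/(_ (le_lt_trans yx x0))]; rewrite ltxx.
  have [xL|Lx] := leP x L; first by rewrite cumul_patch ?x0// W0// x0.
  rewrite -Rintegral_mkcondr (_ : _ `&` _ = `[0, L]%classic).
    by rewrite W0// lexx ltW// period_gt0.
  apply/seteqP; split => y /=; rewrite /torus/= !in_itv/=; first by case.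
  by move=> /andP[y0 yL]; rewrite y0 yL; split=> //; apply: le_trans yL _; exact: ltW.
have lV : locally_integrable [set: R] V by apply: integrable_locally iW; exact: measurable_itv.
have iVx x : mu.-integrable `]-oo, x] (EFin \o V) by exact: integrableS iV.
have := FTC1Ny iVx lV.
apply: filterS; first exact: (ae_filter_ringOfSetsType mu).
move=> y [_]; rewrite derive1E (_ : (fun x => _) = cst 0); last exact/funext.
rewrite derive_cst /V patchE => /esym + Ty; rewrite mem_set//.
by move/eqP; rewrite subr_eq0 => /eqP.
Qed.

End fundamental.

#[local] Hint Resolve measurable_torus : core.

(** * Weak derivatives of square-integrable functions *)

Section weak.
Context {R : realType}.
Notation mu := (@lebesgue_measure R).
Implicit Types (f g u v w phi psi : R -> R).
Local Notation T := (@torus R).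
Local Notation L := (pi *+ 2 : R).

(** Membership in [L2] for one real component. *)
Definition sqint u := measurable_fun setT u /\
  mu.-integrable T (fun y => (u y ^+ 2)%:E).

(** Weak differentiation on the torus for one real component. *)
Definition rweak u v := forall phi, test_function phi ->
  \int[mu]_(y in T) (u y * derive1 phi y) = - \int[mu]_(y in T) (v y * phi y).

Lemma sqint_measurable u : sqint u -> measurable_fun T u.
Proof.
move=> [mu' _]; apply: (@measurable_funS _ _ _ _ setT) => //.
Qed.

Lemma sqintM u v : sqint u -> sqint v -> mu.-integrable T (fun y => (u y * v y)%:E).
Proof.
move=> su sv; have [mu' iu] := su; have [mv iv] := sv.
have iuv := integrableD measurable_torus iu iv.
apply: le_integrable iuv => //.
  by apply/measurable_EFinP; apply: measurable_funM; exact: sqint_measurable.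
move=> y _; rewrite /= lee_fin (@ger0_norm _ (_ + _)) ?addr_ge0 ?sqr_ge0//.
rewrite normrM -(real_normK (num_real (u y))) -(real_normK (num_real (v y))).
by have := sqr_ge0 (`|u y| - `|v y|); have := normr_ge0 (u y); have := normr_ge0 (v y); nra.
Qed.

Lemma sqint_cst (c : R) : sqint (fun=> c).
Proof. by split; [exact: measurable_cst|exact: integrable_torus_cst]. Qed.

Lemma sqint_integrable u : sqint u -> mu.-integrable T (EFin \o u).
Proof.
move=> su; have := sqintM _ _ su (sqint_cst 1).
by apply: eq_integrable => // y _; rewrite /= mulr1.
Qed.

Lemma torus_bound f : continuous f -> exists M, forall x, T x -> `|f x| <= M.
Proof.
move=> cf.
have [|c _ hc] := @EVT_max R (fun x => `|f x|) 0 L (ltW period_gt0).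
  apply: continuous_subspaceT => x; apply: cvg_norm; exact: cf.
by exists `|f c| => x Tx; exact: hc.
Qed.

Lemma integrable_mul_continuous w f : continuous f ->
  mu.-integrable T (EFin \o w) -> mu.-integrable T (fun x => (w x * f x)%:E).
Proof.
move=> cf iw; have [M hM] := torus_bound _ cf.
apply: integrable_mul_bounded hM => //.
apply: (@measurable_funS _ _ _ _ setT) => //; exact: continuous_measurable_fun.
Qed.

Lemma test_deriv phi : test_function phi ->
  [/\ forall x : R, is_derive x 1 phi (derive1 phi x), continuous phi &
      test_function (derive1 phi)].
Proof.
move=> [pp sp].
have dp (x : R) : is_derive x 1 phi (derive1 phi x).
  by apply: DeriveDef; [exact: (sp 0%N)|rewrite derive1E].
split=> //; first exact: deriv1_continuous dp.
split=> [x|n y]; last by have := sp n.+1 y; rewrite /derive1n iterSr.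
have dL : is_derive x 1 phi (derive1 phi (x + L)).
  have -> : phi = (fun y => phi (y + L)) by apply/funext => y; rewrite pp.
  have := @is_derive1_comp _ phi (fun y => y + L) x _ 1 (dp _).
  rewrite mulr1; rewrite {2}(_ : phi = (fun y => phi (y + L))) //=; last by apply/funext => y; rewrite pp.
  apply.
  by have := deriv1D _ _ _ _ _ (is_derive_id x 1) (is_derive_cst L x 1); rewrite addr0.
have [_ e1] := dp x; have [_ e2] := dL.
by rewrite -e2 -e1.
Qed.

(** Testing against constants shows that weak derivatives have zero mean. *)
Lemma test_cst (c : R) : test_function (fun=> c).
Proof.
have dc (k : R) : derive1 (fun=> k) = fun=> 0.
  by apply: deriv1_derive1 => x; exact: is_derive_cst.
split=> // n y; elim: n c y => [c y|n IH c y]; first exact: derivable_cst.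
by rewrite /derive1n iterSr dc; exact: IH.
Qed.

(** The primitive [V] of [v] has, like [u], the weak derivative [v]; it matches
    at the end points because [v] has zero mean. Hence [u - V] is constant almost
    everywhere. *)
Lemma weak_primitive u v : sqint u -> sqint v -> rweak u v ->
  exists w, [/\ primitive L w v, w L = w 0 &
    {ae mu, forall y, T y -> u y = w y}].
Proof.
move=> su sv uv.
have iv := sqint_integrable _ sv.
pose V x := \int[mu]_(t in `[0, x]) v t.
have V0 : V 0 = 0 by rewrite /V set_itv1 Rintegral_set1.
have pV : primitive L V v by split=> // x _; rewrite V0 add0r.
have VL : V L = 0.
  have := uv _ (test_cst 1).
  rewrite (_ : derive1 _ = fun=> 0); last first.
    by apply: deriv1_derive1 => x; exact: is_derive_cst.
  under eq_Rintegral do rewrite mulr0.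
  rewrite Rintegral_torus_cst mul0r.
  under eq_Rintegral do rewrite mulr1.
  by move/eqP; rewrite eq_sym oppr_eq0 => /eqP.
have iV : mu.-integrable T (EFin \o V).
  apply: continuous_compact_integrable; first exact: segment_compact.
  exact: parameterized_integral_continuous (ltW period_gt0) iv.
have hw phi : test_function phi ->
    \int[mu]_(y in T) ((u y - V y) * derive1 phi y) = 0.
  move=> tphi; have [dphi cphi tphi'] := test_deriv _ tphi.
  have [_ cphi' _] := test_deriv _ tphi'.
  have [_ /(_ L)] := primitiveM _ _ _ _ _ (ltW period_gt0) pV
     (primitive_C1 _ _ _ period_gt0 dphi cphi').
  rewrite lexx (ltW period_gt0) => /(_ isT).
  rewrite V0 VL !mul0r add0r RintegralD//; last 2 first.
  - exact: integrable_mul_continuous.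
  - exact: integrable_mul_continuous.
  move=> e.
  under eq_Rintegral do rewrite mulrBl.
  rewrite RintegralB//; last 2 first.
  - by apply: integrable_mul_continuous => //; exact: sqint_integrable.
  - exact: integrable_mul_continuous.
  by rewrite uv// -opprD -[X in - X]e oppr0.
have iw : mu.-integrable T (EFin \o (fun y => u y - V y)).
  have := integrableB measurable_torus (sqint_integrable _ su) iV.
  by apply: eq_integrable => // y _.
have := weakly_constant _ iw hw; set m := _ / _ => hm.
exists (fun x => m + V x); split.
- by split=> // x x0L; rewrite V0 addr0.
- by rewrite VL V0.
apply: filterS hm; first exact: (ae_filter_ringOfSetsType mu).
by move=> y h Ty; have := h Ty => <-; rewrite subrK.
Qed.

(** Integration by parts on the torus against the product of two weakly
    differentiable functions and a [C^1] function. After passing to absolutely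
    continuous representatives, [Z] is the derivative of the periodic function
    [psi u v]. *)
Lemma weak_product_rule u u' v v' psi psi' :
  sqint u -> sqint u' -> rweak u u' -> sqint v -> sqint v' -> rweak v v' ->
  (forall x : R, is_derive x 1 psi (psi' x)) -> continuous psi' ->
  periodic psi L ->
  let Z y := psi' y * (u y * v y) + psi y * (u' y * v y + u y * v' y) in
  mu.-integrable T (EFin \o Z) /\ \int[mu]_(y in T) Z y = 0.
Proof.
move=> su su' wu sv sv' wv dpsi cpsi' ppsi Z.
have cpsi := deriv1_continuous _ _ dpsi.
have [U [pU UL aeU]] := weak_primitive _ _ su su' wu.
have [V [pV VL aeV]] := weak_primitive _ _ sv sv' wv.
have L0 := ltW (@period_gt0 R).
have pP := primitiveM _ _ _ _ _ L0 (primitive_C1 _ _ _ period_gt0 dpsi cpsi')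
  (primitiveM _ _ _ _ _ L0 pU pV).
have mT f : continuous f -> measurable_fun T f.
  move=> cf; apply: (@measurable_funS _ _ _ _ setT) => //.
  exact: continuous_measurable_fun.
have [iP /(_ L)] := pP.
rewrite lexx L0 => /(_ isT).
rewrite UL VL -{1}(add0r L) ppsi => /eqP; rewrite -subr_eq0 opprD addrA subrr add0r oppr_eq0 => /eqP e.
have i1 : mu.-integrable T (EFin \o (fun y => psi' y * (u y * v y))).
  have := integrable_mul_continuous _ _ cpsi' (sqintM _ _ su sv).
  by apply: eq_integrable => // y _ /=; rewrite mulrC.
have i2 : mu.-integrable T (EFin \o (fun y => psi y * (u' y * v y + u y * v' y))).
  have := integrable_mul_continuous _ _ cpsi
    (integrableD measurable_torus (sqintM _ _ su' sv) (sqintM _ _ su sv')).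
  by apply: eq_integrable => // y _ /=; rewrite mulrC.
have iZ : mu.-integrable T (EFin \o Z) := integrableD measurable_torus i1 i2.
split=> //; rewrite -[RHS]e.
congr fine; apply: ae_eq_integral => //.
- exact: measurable_int iZ.
- exact: measurable_int iP.
apply: filterS2 aeU aeV; first exact: (ae_filter_ringOfSetsType mu).
by move=> y hU hV Ty /=; rewrite -hU// -hV.
Qed.

End weak.

(** * Pointwise inequalities for the multipliers *)

Section algebra.
Context {R : realType}.
Implicit Types (S C s l : R).

Lemma young_dot (k x1 x2 y1 y2 : R) : 0 < k ->
  `|x1 * y1 + x2 * y2| <= k / 2 * (x1 ^+ 2 + x2 ^+ 2) + (y1 ^+ 2 + y2 ^+ 2) / (2 * k).
Proof.
move=> k0; rewrite -(ler_pM2l k0) -(ler_pM2l (ltr0n R 2)).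
have -> : 2 * (k * (k / 2 * (x1 ^+ 2 + x2 ^+ 2) + (y1 ^+ 2 + y2 ^+ 2) / (2 * k))) =
  (k * x1) ^+ 2 + (k * x2) ^+ 2 + y1 ^+ 2 + y2 ^+ 2 by field; rewrite gt_eqF.
rewrite -{1}(gtr0_norm k0) -normrM.
have := sqr_ge0 (k * x1 - y1); have := sqr_ge0 (k * x2 - y2).
have := sqr_ge0 (k * x1 + y1); have := sqr_ge0 (k * x2 + y2).
by case: (ler0P (k * (x1 * y1 + x2 * y2))) => _; nra.
Qed.

(** Here [S], [C] and [s] stand for [sin y], [cos y] and [sin y - b] at a point
    [y]. At the length scale [l], the weight [p] measures the distance to the
    critical points of the sine, and [s ^ 2 / Q] that to the critical layer
    [sin y = b]: it is at least [1 / 2] as soon as [s ^ 2 >= l ^ 2 p]. *)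
Section weights.
Context (S C s l : R).
Context (SC : S ^+ 2 + C ^+ 2 = 1) (l0 : 0 < l) (l1 : l <= 1).
Let p := C ^+ 2 + l ^+ 2.
Let Q := s ^+ 2 + l ^+ 2 * p.

Lemma critical_weight_gt0 : 0 < p.
Proof.
by rewrite /p; have := exprn_gt0 2 l0; have := sqr_ge0 C; lra.
Qed.

Lemma layer_weight_gt0 : 0 < Q.
Proof. by rewrite /Q ltr_wpDl ?sqr_ge0// mulr_gt0 ?exprn_gt0// critical_weight_gt0. Qed.

Lemma lC_le_p : 2 * (l * `|C|) <= p.
Proof.
rewrite /p -(real_normK (num_real C)); have := sqr_ge0 (l - `|C|); nra.
Qed.

Lemma lsC_le_Q : 2 * (l * `|s| * `|C|) <= Q.
Proof.
rewrite /Q /p -(real_normK (num_real C)) -(real_normK (num_real s)).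
have := sqr_ge0 (`|s| - l * `|C|); have := sqr_ge0 (l ^+ 2); nra.
Qed.

Lemma l2s_le_Q : 2 * (l ^+ 2 * `|s|) <= Q.
Proof.
rewrite /Q /p -(real_normK (num_real s)).
have := sqr_ge0 (`|s| - l ^+ 2); have := sqr_ge0 (l * C); nra.
Qed.

Lemma chi_le : `|l ^+ 2 * s / Q| <= 1 / 2.
Proof.
have Q0 := layer_weight_gt0.
rewrite (normrM _ Q^-1) (normrM (l ^+ 2)) normfV (gtr0_norm Q0) (ger0_norm (sqr_ge0 l)) ler_pdivrMr//.
have := l2s_le_Q; lra.
Qed.

Lemma norm_S_le1 : `|S| <= 1.
Proof.
rewrite -(@expr_le1 _ 2)// real_normK ?num_real// -SC lerDl; exact: sqr_ge0.
Qed.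

(** The multiplier [l ^ 2 s / Q] is near the critical layer a smooth substitute for
    the sign of [s]. It never varies on a scale shorter than [l], even where [s] has a simple zero. *)
Lemma chi'_le :
  `|l ^+ 2 * (C / Q + s * (- (2 * s * C - 2 * l ^+ 2 * C * S) * Q^-1 ^+ 2))| <= 3 / (2 * l).
Proof.
have Q0 := layer_weight_gt0; have p0 := critical_weight_gt0.
have -> : l ^+ 2 * (C / Q + s * (- (2 * s * C - 2 * l ^+ 2 * C * S) * Q^-1 ^+ 2)) =
  l ^+ 2 * (C * (l ^+ 2 * p - s ^+ 2) / Q ^+ 2) + (2 * l ^+ 4 * s * C * S) / Q ^+ 2.
  by rewrite /Q; field; rewrite gt_eqF.
apply: le_trans (ler_normD _ _) _.
have -> : 3 / (2 * l) = 1 / (2 * l) + 1 / l by field; rewrite gt_eqF.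
apply: lerD.
- have h : `|l ^+ 2 * p - s ^+ 2| <= Q.
    have := sqr_ge0 s; have : 0 <= l ^+ 2 * p by rewrite mulr_ge0 ?sqr_ge0// ltW.
    by rewrite /Q; case: ler0P; lra.
  rewrite (normrM (l ^+ 2)) (normrM _ (Q ^+ 2)^-1) (normrM C) normfV.
  rewrite (ger0_norm (sqr_ge0 l)) (ger0_norm (sqr_ge0 Q)).
  rewrite !mulrA ler_pdivrMr ?exprn_gt0// [leRHS]mulrAC.
  rewrite ler_pdivlMr ?mulr_gt0//.
  have h1 := lC_le_p.
  have h2 : l ^+ 2 * p <= Q by rewrite /Q lerDr sqr_ge0.
  have C0 := normr_ge0 C; set X := `|_ - _| in h *.
  have X0 : 0 <= X by rewrite /X.
  have h3 : l ^+ 2 * (2 * (l * `|C|)) <= Q.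
    by apply: le_trans h2; rewrite ler_wpM2l ?sqr_ge0.
  have h4 : (l ^+ 2 * (2 * (l * `|C|))) * X <= Q * Q.
    by apply: ler_pM => //; rewrite !mulr_ge0 ?sqr_ge0// ltW.
  by rewrite mul1r; lra.
- rewrite (normrM _ (Q ^+ 2)^-1) (normrM _ S) (normrM _ C) (normrM _ s) (normrM 2) normfV.
  rewrite (ger0_norm (sqr_ge0 Q)) (ger0_norm (ltW (exprn_gt0 4 l0))).
  rewrite (@ger0_norm _ 2)// ler_pdivrMr ?exprn_gt0// [leRHS]mulrAC mul1r ler_pdivlMr//.
  have h1 := lsC_le_Q.
  have h2 : l ^+ 4 <= Q.
    rewrite /Q /p; have := sqr_ge0 s; have := sqr_ge0 (l * C).
    have -> : l ^+ 4 = l ^+ 2 * l ^+ 2 by ring.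
    by rewrite exprMn; lra.
  have h3 : (2 * (l * `|s| * `|C|)) * l ^+ 4 <= Q * Q.
    by apply: ler_pM => //; rewrite ?mulr_ge0 ?exprn_ge0 ?normr_ge0// ltW.
  have h4 : 2 * l ^+ 4 * `|s| * `|C| * `|S| * l <= 2 * l ^+ 4 * `|s| * `|C| * 1 * l.
    rewrite ler_wpM2r ?(ltW l0)// ler_wpM2l ?norm_S_le1//.
    by rewrite !mulr_ge0 ?exprn_ge0 ?normr_ge0// ltW.
  by rewrite expr2; lra.
Qed.

Lemma psi_le : `|- l * (S * C / p) + 5 * (l * (s * C / Q))| <= 3.
Proof.
have Q0 := layer_weight_gt0; have p0 := critical_weight_gt0.
have hp : `|l * (S * C / p)| <= 1 / 2.
  rewrite !normrM normfV (gtr0_norm p0) (gtr0_norm l0) !mulrA ler_pdivrMr//.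
  have h : l * `|S| * `|C| <= l * 1 * `|C|.
    by rewrite ler_wpM2r ?normr_ge0// ler_wpM2l ?norm_S_le1 ?(ltW l0)//.
  by have := lC_le_p; lra.
have hQ : `|l * (s * C / Q)| <= 1 / 2.
  rewrite !normrM normfV (gtr0_norm Q0) (gtr0_norm l0) !mulrA ler_pdivrMr//.
  by have := lsC_le_Q; lra.
apply: le_trans (ler_normD _ _) _.
by rewrite mulNr normrN [`|5 * _|]normrM (@ger0_norm _ 5)//; lra.
Qed.

(** The Hardy-type inequality that makes the estimate close: a point is either
    at distance from the critical layer, where [s ^ 2 / Q] is bounded below, or
    in a region of width [l] where the derivative of the bounded function [psi]
    is at least of order [1 / l]. The first summand of [psi] deals with the
    critical points of the sine and the second one with the simple zeros of
    [s]. *)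
Lemma one_le_weights :
  1 <= 2 * l * (- l * ((C * C - S * S) / p + S * C * (2 * C * S * p^-1 ^+ 2))
      + 5 * (l * ((C * C - s * S) / Q +
             s * C * (- (2 * s * C - 2 * l ^+ 2 * C * S) * Q^-1 ^+ 2))))
    + 255 * (s ^+ 2 / Q).
Proof.
have Q0 := layer_weight_gt0; have p0 := critical_weight_gt0.
have pN0 : p != 0 by rewrite gt_eqF.
have QN0 : Q != 0 by rewrite gt_eqF.
pose u := C ^+ 2 / p; pose v := s ^+ 2 / Q; pose j := l ^+ 2 * s / Q.
have u0 : 0 <= u by rewrite divr_ge0 ?sqr_ge0// ltW.
have v0 : 0 <= v by rewrite divr_ge0 ?sqr_ge0// ltW.
have u1 : 1 - u = l ^+ 2 / p by rewrite /u /p; field.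
have v1 : 1 - v = l ^+ 2 * p / Q by rewrite /v /Q; field.
have u1' : 0 <= 1 - u by rewrite u1 divr_ge0 ?sqr_ge0// ltW.
have v1' : 0 <= 1 - v by rewrite v1 divr_ge0// ?mulr_ge0 ?sqr_ge0// ltW.
have E1 : l * (- l * ((C * C - S * S) / p + S * C * (2 * C * S * p^-1 ^+ 2))) =
   - l ^+ 2 * u + S ^+ 2 * ((1 - u) * (1 - 2 * u)).
  by rewrite /u /p; field.
have E2 : l * (l * ((C * C - s * S) / Q +
             s * C * (- (2 * s * C - 2 * l ^+ 2 * C * S) * Q^-1 ^+ 2))) =
   u * (1 - v) - j * S - 2 * v * (u * (1 - v)) + 2 * (j * S) * (u * (1 - v)).
  by rewrite v1 /u /v /j; field; rewrite QN0 pN0.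
have lu : C ^+ 2 * (1 - u) = l ^+ 2 * u by rewrite u1 /u; field.
have l2 : l ^+ 2 <= 1 by rewrite expr_le1 ?(ltW l0)//.
(* The first summand is at least 1 up to five times [u], which the factor 5 in
   front of the second summand compensates. *)
have b1 : 1 - 5 * u <= - l ^+ 2 * u + S ^+ 2 * ((1 - u) * (1 - 2 * u)).
  have -> : S ^+ 2 = 1 - C ^+ 2 by rewrite -SC; ring.
  have lu2 : l ^+ 2 * u <= u by rewrite ler_piMl.
  have lu0 : 0 <= l ^+ 2 * u by rewrite mulr_ge0 ?sqr_ge0.
  have -> : (1 - C ^+ 2) * ((1 - u) * (1 - 2 * u)) =
     (1 - 3 * u + 2 * u ^+ 2) - l ^+ 2 * u * (1 - 2 * u) by rewrite -lu; ring.
  have h : 0 <= u * (l ^+ 2 * u) by rewrite mulr_ge0.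
  have := sqr_ge0 u; nra.
(* The terms with [j] are absorbed by Young's inequality with constant 1 / 30. *)
have jv : j ^+ 2 <= v.
  have -> : j ^+ 2 = v * (l ^+ 4 / Q) by rewrite /j /v; field.
  rewrite ler_piMr// ler_pdivrMr// mul1r /Q /p.
  have := sqr_ge0 s; have := sqr_ge0 (l * C).
  have -> : l ^+ 4 = l ^+ 2 * l ^+ 2 by ring.
  by rewrite exprMn; lra.
have jS : `|j * S| <= 1 / 30 + 15 / 2 * v.
  rewrite normrM; apply: (@le_trans _ _ `|j|).
    by rewrite ler_piMr ?normr_ge0 ?norm_S_le1.
  move: jv; rewrite -(real_normK (num_real j)).
  by have := sqr_ge0 (`|j| - 1 / 15); have := normr_ge0 j; nra.
set k := u * (1 - v) in E2.
have k0 : 0 <= k by rewrite mulr_ge0.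
have k1 : k <= 1 by rewrite /k; nra.
have ku : u - v <= k by rewrite /k; nra.
have vk : v * k <= v by rewrite ler_piMr.
have jSk : - `|j * S| <= j * S * k.
  have := ler_norm (j * S); have := ler_norm (- (j * S)); rewrite normrN.
  by nra.
have jS_le := ler_norm (j * S).
rewrite -[s ^+ 2 / Q]/v.
move: E1 E2.
set X1 := - l * _; set X2 := l * (_ / Q + _); rewrite -[l * _]/(l * X1) => E1 E2.
have -> : 2 * l * (X1 + 5 * X2) = 2 * (l * X1) + 10 * (l * X2) by ring.
by rewrite E1 E2; lra.
Qed.

End weights.

(** The numerical bookkeeping of [resolvent_density]: [B] bounds the contribution
    of the equation, [G] that of the derivative of [f]. With the constant
    [500 ^ -2] the coefficient of [n] on the right stays below [3 / 5]. *)
Lemma collect_constants (A n z1 z2 z3 G w1 w2 w3 : R) : 0 <= A -> 0 <= n ->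
  let B := 5 / 2 * (A / 500 / 500) + n / 500 / 1000 in
  w1 <= 3 * (250 * G + n / 1000) -> w2 <= 1 / 2 * B ->
  w3 <= 3 / 2 * (250 * G + n / 1000) -> G <= z1 + B ->
  n <= z3 + 4 * w1 + (255 * w2 + (z2 + 255 * w3)) ->
  n <= 3 / 5 * n + A + 789 / 2 * 250 * z1 + z2 + z3.
Proof. by cbv zeta => A0 n0 b1 b2 b3 b4 b5; lra. Qed.

(** The pointwise form of the resolvent estimate. The [fi], [gi], [hi] are the
    real and imaginary parts of [f], [f'], [f''] at a point, and [F1], [F2]
    those of the equation's left-hand side. The last three terms are the
    densities of the identities obtained by testing with [f], with [i chi f],
    and by integrating the derivative of [psi |f| ^ 2]; they integrate to
    zero. The derivative [f'] is eliminated by the first identity, which bounds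
    [eps |f'| ^ 2] by [F f]. *)
Lemma resolvent_density (s l a f1 f2 g1 g2 h1 h2 chi chi' psi psi' v : R) :
  0 < l -> 0 < a ->
  `|chi| <= 1 / 2 -> `|chi'| <= 3 / (2 * l) -> `|psi| <= 3 ->
  1 <= 2 * l * psi' + 255 * v -> s * chi = l ^+ 2 * v ->
  let eps := a * l ^+ 4 in let M := a * l ^+ 2 in let c := (500^-1 ^+ 2 : R) in
  let F1 := - eps * h1 - a * s * f2 in let F2 := - eps * h2 + a * s * f1 in
  let n := f1 ^+ 2 + f2 ^+ 2 in
  n <= 3 / 5 * n + (5 * (c * M) ^+ 2)^-1 * (F1 ^+ 2 + F2 ^+ 2)
    + 789 / 2 * 250 * l ^+ 2 * (h1 * f1 + g1 * g1 + (h2 * f2 + g2 * g2))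
    + 255 * l ^+ 2 * (chi' * (g2 * f1) + chi * (h2 * f1 + g2 * g1)
                      - (chi' * (g1 * f2) + chi * (h1 * f2 + g1 * g2)))
    + 2 * l * (psi' * (f1 * f1) + psi * (g1 * f1 + f1 * g1)
               + (psi' * (f2 * f2) + psi * (g2 * f2 + f2 * g2))).
Proof.
move=> l0 a0 chi_le chi'_le psi_le w1 schi; cbv zeta.
set eps := a * l ^+ 4; set M := a * l ^+ 2; have c0 : (0 : R) < 500^-1 ^+ 2 by apply: exprn_gt0; rewrite invr_gt0 ltr0n.
move: c0; have [c cE] : exists c : R, c = 500^-1 ^+ 2 by exists (500^-1 ^+ 2).
rewrite -cE => c0.
set F1 := - eps * h1 - _; set F2 := - eps * h2 + _; set n := f1 ^+ 2 + f2 ^+ 2.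
pose FF := F1 ^+ 2 + F2 ^+ 2; pose gg := g1 ^+ 2 + g2 ^+ 2.
have l2 : 0 < l ^+ 2 by rewrite exprn_gt0.
have M0 : 0 < M by rewrite mulr_gt0.
have n0 : 0 <= n by rewrite addr_ge0 ?sqr_ge0.
have epsE : eps = M * l ^+ 2 by rewrite /eps /M; ring.
(* Young's inequality with parameter [1 / (c M)] for [F] against [f], and with
   parameter [500 l = l / sqrt c] for [f'] against [f]. *)
pose cM := c * M; have cM0 : 0 < cM by rewrite mulr_gt0.
pose Y := FF / (2 * cM) + cM * n / 2.
have Fn (x1 x2 : R) : x1 ^+ 2 + x2 ^+ 2 = n -> `|F1 * x1 + F2 * x2| <= Y.
  move=> e; apply: le_trans (@young_dot cM^-1 F1 F2 x1 x2 _) _; first by rewrite invr_gt0.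
  rewrite e /Y -/FF le_eqVlt; apply/orP; left; apply/eqP; field.
  by rewrite gt_eqF.
pose X := 250 * l * gg + n / (1000 * l).
have gn (x1 x2 : R) : x1 ^+ 2 + x2 ^+ 2 = n -> `|g1 * x1 + g2 * x2| <= X.
  move=> e; have K0 : 0 < 500 * l by rewrite mulr_gt0 ?ltr0n.
  apply: le_trans (@young_dot (500 * l) g1 g2 x1 x2 K0) _.
  rewrite e /X -/gg le_eqVlt; apply/orP; left; apply/eqP; field.
  by rewrite gt_eqF.
have X0 : 0 <= X by apply: le_trans (gn f1 f2 erefl).
have Y0 : 0 <= Y by apply: le_trans (Fn f1 f2 erefl).
have nE : (- f2) ^+ 2 + f1 ^+ 2 = n by rewrite sqrrN addrC.
have t1 : - psi * (g1 * f1 + g2 * f2) <= 3 * X.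
  apply: le_trans (ler_norm _) _; rewrite normrM normrN.
  by apply: ler_pM => //; exact: gn.
have t2 : chi * (F1 * - f2 + F2 * f1) <= 1 / 2 * Y.
  apply: le_trans (ler_norm _) _; rewrite normrM.
  by apply: ler_pM => //; exact: Fn.
have t3 : - chi' * (g1 * - f2 + g2 * f1) <= 3 / (2 * l) * X.
  apply: le_trans (ler_norm _) _; rewrite normrM normrN.
  by apply: ler_pM => //; exact: gn.
have t4 : F1 * f1 + F2 * f2 <= Y by apply: le_trans (ler_norm _) _; exact: Fn.
have e4 : F1 * f1 + F2 * f2 = - eps * (h1 * f1 + h2 * f2) by rewrite /F1 /F2; ring.
have e2 : chi * (F1 * - f2 + F2 * f1) = M * v * n - eps * (chi * (h2 * f1 - h1 * f2)).
  have -> : M * v * n = a * (s * chi) * n by rewrite schi /M; ring.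
  by rewrite /F1 /F2 /n; ring.
have e5 : 255 * v * n = 255 * (chi * (F1 * - f2 + F2 * f1) / M) +
    255 * l ^+ 2 * (chi * (h2 * f1 - h1 * f2)).
  by rewrite e2 epsE; field; rewrite gt_eqF.
have b2 : chi * (F1 * - f2 + F2 * f1) / M <= 1 / 2 * (Y / M).
  by rewrite mulrA ler_wpM2r// invr_ge0 ltW.
have b3 : l ^+ 2 * (- chi' * (g1 * - f2 + g2 * f1)) <= 3 / 2 * (l * X).
  have -> : 3 / 2 * (l * X) = l ^+ 2 * (3 / (2 * l) * X) by field; rewrite gt_eqF.
  by rewrite ler_wpM2l// ltW.
have b1 : l * (- psi * (g1 * f1 + g2 * f2)) <= 3 * (l * X).
  by rewrite [leRHS]mulrCA ler_wpM2l// ltW.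
have lX : l * X = 250 * (l ^+ 2 * gg) + n / 1000.
  by rewrite /X; field; rewrite gt_eqF.
have b4 : l ^+ 2 * gg <= l ^+ 2 * (h1 * f1 + g1 * g1 + (h2 * f2 + g2 * g2)) + Y / M.
  rewrite -(ler_pM2l M0) [leRHS]mulrDr (mulrC M (Y / M)) divfK ?gt_eqF//.
  move: t4; rewrite e4 epsE /gg; lra.
have yM : Y / M = FF * (2 * c * M ^+ 2)^-1 + c * n / 2.
  by rewrite /Y /cM; field; rewrite !gt_eqF.
have FFc : FF * (2 * c * M ^+ 2)^-1 = c / 2 * (5 * ((5 * (c * M) ^+ 2)^-1 * FF)).
  by field; rewrite !gt_eqF.
have FF0 : 0 <= (5 * (c * M) ^+ 2)^-1 * FF.
  apply: mulr_ge0; last by rewrite addr_ge0 ?sqr_ge0.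
  by rewrite invr_ge0 mulr_ge0 ?sqr_ge0 ?ler0n.
have w1n : n <= 2 * l * psi' * n + 255 * v * n by rewrite -[leRHS]mulrDl; apply: ler_peMl.
rewrite -/FF.
move: w1n; rewrite e5.
set A := (5 * (c * M) ^+ 2)^-1 * FF in FFc FF0 *.
set B := Y / M in b2 b4 yM *.
have B1 : B = 5 / 2 * (A / 500 / 500) + n / 500 / 1000.
  by rewrite yM FFc cE; field.
have n1 : 2 * l * psi' * n = 2 * l * (psi' * (f1 * f1) + psi * (g1 * f1 + f1 * g1)
               + (psi' * (f2 * f2) + psi * (g2 * f2 + f2 * g2))) +
     4 * (l * (- psi * (g1 * f1 + g2 * f2))) by rewrite /n; ring.
have n2 : 255 * l ^+ 2 * (chi * (h2 * f1 - h1 * f2)) =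
  255 * l ^+ 2 * (chi' * (g2 * f1) + chi * (h2 * f1 + g2 * g1)
                      - (chi' * (g1 * f2) + chi * (h1 * f2 + g1 * g2))) +
  255 * (l ^+ 2 * (- chi' * (g1 * - f2 + g2 * f1))) by ring.
rewrite n1 n2; move: b1 b2 b3; rewrite lX => b1 b2 b3.
rewrite -[789 / 2 * 250 * l ^+ 2 * _]mulrA.
move: b1 b2 b3 b4; rewrite B1.
exact: (collect_constants _ _ _ _ _ _ _ _ _ FF0 n0).
Qed.

End algebra.

(** * The resolvent estimate for real components *)

Section resolvent.
Context {R : realType}.
Notation mu := (@lebesgue_measure R).
Implicit Types (f g u v w : R -> R).
Local Notation T := (@torus R).
Local Notation L := (pi *+ 2 : R).

Lemma continuous_add f g : continuous f -> continuous g -> continuous (fun x => f x + g x).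
Proof. by move=> cf cg x; apply: cvgD; [exact: cf|exact: cg]. Qed.

Lemma continuous_mul f g : continuous f -> continuous g -> continuous (fun x => f x * g x).
Proof. by move=> cf cg x; apply: cvgM; [exact: cf|exact: cg]. Qed.

Lemma continuous_opp f : continuous f -> continuous (fun x => - f x).
Proof. by move=> cf x; apply: cvgN; exact: cf. Qed.

Lemma continuous_inv f : continuous f -> (forall x, f x != 0) ->
  continuous (fun x => (f x)^-1).
Proof. by move=> cf f0 x; apply: cvgV; [exact: f0|exact: cf]. Qed.

Lemma continuous_pow f n : continuous f -> continuous (fun x => f x ^+ n).
Proof.
move=> cf; elim: n => [|n IH]; first by move=> x; exact: cvg_cst.
by under eq_fun do rewrite exprS; exact: continuous_mul.
Qed.

Lemma deriv1_eq f g (x a b : R) : is_derive x 1 f a ->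
  (forall z, f z = g z) -> a = b -> is_derive x 1 g b.
Proof. by move=> fa /funext <- <-. Qed.

Lemma deriv1_cst (c x : R) : is_derive x 1 (fun=> c : R) 0.
Proof. exact: is_derive_cst. Qed.

Section weights.
Context (l b : R) (l0 : 0 < l).
Let s y : R := sin y - b.
Let p y : R := cos y ^+ 2 + l ^+ 2.
Let Q y : R := s y ^+ 2 + l ^+ 2 * p y.

(** The multiplier that detects the sign of [sin y - b] at scale [l]. *)
Definition chi y := l ^+ 2 * s y / Q y.
Definition chi' y := l ^+ 2 * (cos y / Q y +
  s y * (- (2 * s y * cos y - 2 * l ^+ 2 * cos y * sin y) * (Q y)^-1 ^+ 2)).
(** The function whose derivative is large at scale [l] on the critical layer, see
    [one_le_weights]. *)
Definition psi y := - l * (sin y * cos y / p y) + 5 * (l * (s y * cos y / Q y)).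
Definition psi' y :=
  - l * ((cos y * cos y - sin y * sin y) / p y
         + sin y * cos y * (2 * cos y * sin y * (p y)^-1 ^+ 2))
  + 5 * (l * ((cos y * cos y - s y * sin y) / Q y
         + s y * cos y * (- (2 * s y * cos y - 2 * l ^+ 2 * cos y * sin y) * (Q y)^-1 ^+ 2))).

Let pN0 y : p y != 0. Proof. by rewrite gt_eqF// critical_weight_gt0. Qed.
Let QN0 y : Q y != 0. Proof. by rewrite gt_eqF// layer_weight_gt0. Qed.

Lemma deriv_s (y : R) : is_derive y 1 s (cos y).
Proof. by apply: deriv1_eq (deriv1D _ _ _ _ _ (is_derive_sin y) (deriv1_cst (- b) y)) _ _; rewrite ?addr0. Qed.

Lemma deriv_p (y : R) : is_derive y 1 p (- (2 * cos y * sin y)).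
Proof.
have d := deriv1M _ _ _ _ _ (is_derive_cos y) (is_derive_cos y).
by apply: deriv1_eq (deriv1D _ _ _ _ _ d (deriv1_cst (l ^+ 2) y)) _ _; [|ring].
Qed.

Lemma deriv_Q (y : R) :
  is_derive y 1 Q (2 * s y * cos y - 2 * l ^+ 2 * cos y * sin y).
Proof.
have d1 := deriv1M _ _ _ _ _ (deriv_s y) (deriv_s y).
have d2 := deriv1M _ _ _ _ _ (deriv1_cst (l ^+ 2) y) (deriv_p y).
by apply: deriv1_eq (deriv1D _ _ _ _ _ d1 d2) _ _; [|ring].
Qed.

Let deriv_Vp y := deriv1V _ _ _ (pN0 y) (deriv_p y).
Let deriv_VQ y := deriv1V _ _ _ (QN0 y) (deriv_Q y).

Lemma deriv_chi (y : R) : is_derive y 1 chi (chi' y).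
Proof.
have d := deriv1M _ _ _ _ _ (deriv_s y) (deriv_VQ y).
apply: deriv1_eq (deriv1M _ _ _ _ _ (deriv1_cst (l ^+ 2) y) d) _ _.
  by move=> z; rewrite /chi mulrA.
by rewrite /chi'; ring.
Qed.

Lemma deriv_psi (y : R) : is_derive y 1 psi (psi' y).
Proof.
have d1 := deriv1M _ _ _ _ _ (deriv1M _ _ _ _ _ (is_derive_sin y) (is_derive_cos y)) (deriv_Vp y).
have d2 := deriv1M _ _ _ _ _ (deriv1M _ _ _ _ _ (deriv_s y) (is_derive_cos y)) (deriv_VQ y).
have d3 := deriv1M _ _ _ _ _ (deriv1_cst (- l) y) d1.
have d4 := deriv1M _ _ _ _ _ (deriv1_cst 5 y) (deriv1M _ _ _ _ _ (deriv1_cst l y) d2).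
apply: deriv1_eq (deriv1D _ _ _ _ _ d3 d4) _ _ => //.
by rewrite /psi'; ring.
Qed.

Let cs : continuous s := deriv1_continuous _ _ deriv_s.
Let cp : continuous p := deriv1_continuous _ _ deriv_p.
Let cQ : continuous Q := deriv1_continuous _ _ deriv_Q.
Let cc : continuous (cos : R -> R). Proof. exact: continuous_cos. Qed.
Let csin : continuous (sin : R -> R). Proof. exact: continuous_sin. Qed.
Let ck (k : R) : continuous (fun _ : R => k). Proof. by move=> x; exact: cvg_cst. Qed.

Let cVQ := continuous_inv _ cQ QN0.
Let cVp := continuous_inv _ cp pN0.
Let cdVQ := continuous_mul _ _ (continuous_opp _ (continuous_add _ _
  (continuous_mul _ _ (continuous_mul _ _ (ck 2) cs) cc)
  (continuous_opp _ (continuous_mul _ _ (continuous_mul _ _ (ck (2 * l ^+ 2)) cc) csin))))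
  (continuous_pow _ 2 cVQ).

Lemma continuous_chi' : continuous chi'.
Proof.
exact: (continuous_mul _ _ (ck (l ^+ 2)) (continuous_add _ _
  (continuous_mul _ _ cc cVQ) (continuous_mul _ _ cs cdVQ))).
Qed.

Lemma continuous_psi' : continuous psi'.
Proof.
have cp' := continuous_add _ _ (continuous_mul _ _ (continuous_add _ _
    (continuous_mul _ _ cc cc) (continuous_opp _ (continuous_mul _ _ csin csin))) cVp)
  (continuous_mul _ _ (continuous_mul _ _ csin cc) (continuous_mul _ _
    (continuous_mul _ _ (continuous_mul _ _ (ck 2) cc) csin) (continuous_pow _ 2 cVp))).
have cQ' := continuous_add _ _ (continuous_mul _ _ (continuous_add _ _
    (continuous_mul _ _ cc cc) (continuous_opp _ (continuous_mul _ _ cs csin))) cVQ)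
  (continuous_mul _ _ (continuous_mul _ _ cs cc) cdVQ).
exact: (continuous_add _ _ (continuous_mul _ _ (ck (- l)) cp')
  (continuous_mul _ _ (ck 5) (continuous_mul _ _ (ck l) cQ'))).
Qed.

Lemma periodic_chi : periodic chi L.
Proof. by move=> y; rewrite /chi /Q /p /s sinD2pi cosD2pi. Qed.

Lemma periodic_psi : periodic psi L.
Proof. by move=> y; rewrite /psi /Q /p /s sinD2pi cosD2pi. Qed.

End weights.

Lemma sqintD u v : sqint u -> sqint v -> sqint (fun y => u y + v y).
Proof.
move=> su sv; have [mu' iu] := su; have [mv iv] := sv.
split; first exact: measurable_funD.
have := integrableD measurable_torus (integrableD measurable_torus iu iv)
  (integrableZl measurable_torus 2 (sqintM _ _ su sv)).
by apply: eq_integrable => // y _; rewrite /= -EFinM -!EFinD; congr EFin; ring.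
Qed.

Lemma sqint_mul_continuous u w : continuous w -> sqint u -> sqint (fun y => w y * u y).
Proof.
move=> cw [mu' iu]; split.
  by apply: measurable_funM => //; exact: continuous_measurable_fun.
have := integrable_mul_continuous _ _ (continuous_pow _ 2 cw) iu.
by apply: eq_integrable => // y _ /=; congr EFin; rewrite exprMn mulrC.
Qed.

Lemma sqint_sqr u : sqint u -> mu.-integrable T (EFin \o (fun y => u y ^+ 2)).
Proof. by case. Qed.

Lemma integrable_add f g : mu.-integrable T (EFin \o f) ->
  mu.-integrable T (EFin \o g) -> mu.-integrable T (EFin \o (fun y => f y + g y)).
Proof. exact: integrableD. Qed.

Lemma integrable_scale (k : R) f : mu.-integrable T (EFin \o f) ->
  mu.-integrable T (EFin \o (fun y => k * f y)).
Proof. exact: integrableZl. Qed.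

Lemma integrable_opp f : mu.-integrable T (EFin \o f) ->
  mu.-integrable T (EFin \o (fun y => - f y)).
Proof. exact: integrableN. Qed.

(** The scale [l] balances dissipation [eps / l ^ 2 = a l ^ 2] and transport, as
    [sin y - b] has size [l ^ 2] at distance [l] from a degenerate zero.
    Integrating [resolvent_density] gives the bound. *)
Lemma real_resolvent (a b l : R) f1 f2 g1 g2 h1 h2 F1 F2 :
  0 < a -> 0 < l -> l <= 1 ->
  sqint f1 -> sqint f2 -> sqint g1 -> sqint g2 -> sqint h1 -> sqint h2 ->
  rweak f1 g1 -> rweak f2 g2 -> rweak g1 h1 -> rweak g2 h2 ->
  \int[mu]_(y in T) (f1 y ^+ 2 + f2 y ^+ 2) = 1 ->
  (forall y, F1 y = - (a * l ^+ 4) * h1 y - a * (sin y - b) * f2 y) ->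
  (forall y, F2 y = - (a * l ^+ 4) * h2 y + a * (sin y - b) * f1 y) ->
  2 * (500^-1 ^+ 2 * (a * l ^+ 2)) ^+ 2 <= \int[mu]_(y in T) (F1 y ^+ 2 + F2 y ^+ 2).
Proof.
move=> a0 l0 l1 sf1 sf2 sg1 sg2 sh1 sh2 fg1 fg2 gh1 gh2 n1 F1E F2E.
have dchi := deriv_chi l b l0; have dpsi := deriv_psi l b l0.
have cchi' := continuous_chi' l b l0; have cpsi' := continuous_psi' l b l0.
have pchi := periodic_chi l b; have ppsi := periodic_psi l b.
have d1 (y : R) := deriv1_cst 1 y.
have p1 : periodic (fun=> 1 : R) L by [].
have c0 : continuous (fun _ : R => 0 : R) by move=> x; exact: cvg_cst.
have [iA1 A1] := weak_product_rule _ _ _ _ _ _ sg1 sh1 gh1 sf1 sg1 fg1 d1 c0 p1.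
have [iA2 A2] := weak_product_rule _ _ _ _ _ _ sg2 sh2 gh2 sf2 sg2 fg2 d1 c0 p1.
have [iB1 B1] := weak_product_rule _ _ _ _ _ _ sg2 sh2 gh2 sf1 sg1 fg1 dchi cchi' pchi.
have [iB2 B2] := weak_product_rule _ _ _ _ _ _ sg1 sh1 gh1 sf2 sg2 fg2 dchi cchi' pchi.
have [iC1 C1] := weak_product_rule _ _ _ _ _ _ sf1 sg1 fg1 sf1 sg1 fg1 dpsi cpsi' ppsi.
have [iC2 C2] := weak_product_rule _ _ _ _ _ _ sf2 sg2 fg2 sf2 sg2 fg2 dpsi cpsi' ppsi.
have ck (k : R) : continuous (fun _ : R => k) by move=> x; exact: cvg_cst.
have cS (k : R) : continuous (fun y : R => k * (a * (sin y - b))).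
  apply: continuous_mul; first by move=> x; exact: cvg_cst.
  apply: continuous_mul; first by move=> x; exact: cvg_cst.
  by apply: continuous_add; [exact: continuous_sin|move=> x; exact: cvg_cst].
have sF1 : sqint F1.
  have := sqintD _ _ (sqint_mul_continuous _ _ (ck (- (a * l ^+ 4))) sh1)
    (sqint_mul_continuous _ _ (cS (-1)) sf2).
  by congr sqint; apply/funext => y; rewrite F1E; ring.
have sF2 : sqint F2.
  have := sqintD _ _ (sqint_mul_continuous _ _ (ck (- (a * l ^+ 4))) sh2)
    (sqint_mul_continuous _ _ (cS 1) sf1).
  by congr sqint; apply/funext => y; rewrite F2E; ring.
have iN := integrable_add _ _ (sqint_sqr _ sf1) (sqint_sqr _ sf2).
have iF := integrable_add _ _ (sqint_sqr _ sF1) (sqint_sqr _ sF2).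
have iA := integrable_add _ _ iA1 iA2.
have iB := integrable_add _ _ iB1 (integrable_opp _ iB2).
have iC := integrable_add _ _ iC1 iC2.
set cM := 500^-1 ^+ 2 * (a * l ^+ 2).
pose k1 := (789 / 2 * 250 * l ^+ 2 : R); pose k2 := 255 * l ^+ 2; pose k3 := 2 * l.
have iNF := integrable_add _ _ (integrable_scale (3 / 5) _ iN)
   (integrable_scale ((5 * cM ^+ 2)^-1) _ iF).
have iNFA := integrable_add _ _ iNF (integrable_scale k1 _ iA).
have iNFB := integrable_add _ _ iNFA (integrable_scale k2 _ iB).
have := @le_Rintegral _ _ _ mu T _ _ measurable_torus iN
  (integrable_add _ _ iNFB (integrable_scale k3 _ iC)) _.
rewrite n1.
rewrite (RintegralD _ iNFB (integrable_scale k3 _ iC))//.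
rewrite (RintegralD _ iNFA (integrable_scale k2 _ iB))//.
rewrite (RintegralD _ iNF (integrable_scale k1 _ iA))//.
rewrite (RintegralD _ (integrable_scale (3 / 5) _ iN) (integrable_scale ((5 * cM ^+ 2)^-1) _ iF))//.
rewrite (RintegralZl _ _ iN)// (RintegralZl _ _ iF)// (RintegralZl _ _ iA)//.
rewrite (RintegralZl _ _ iB)// (RintegralZl _ _ iC)//.
rewrite (RintegralD _ iA1 iA2)// (RintegralB _ iB1 iB2)// (RintegralD _ iC1 iC2)//.
rewrite A1 A2 B1 B2 C1 C2 n1 subr0 addr0 !mulr0 !addr0.
set I := Rintegral _ _ _ => h.
have cM0 : 0 < cM by rewrite /cM !mulr_gt0 ?exprn_gt0 ?invr_gt0 ?ltr0n.
have {}h : 1 <= 3 / 5 * 1 + (5 * cM ^+ 2)^-1 * I.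
  apply: h => y _.
  have SC : sin y ^+ 2 + cos y ^+ 2 = 1 by rewrite addrC cos2Dsin2.
  have := resolvent_density (sin y - b) l a (f1 y) (f2 y) (g1 y) (g2 y)
    (h1 y) (h2 y) (chi l b y) (chi' l b y) (psi l b y) (psi' l b y)
    ((sin y - b) ^+ 2 / ((sin y - b) ^+ 2 + l ^+ 2 * (cos y ^+ 2 + l ^+ 2))) l0 a0
    (chi_le _ _ _ l0) (chi'_le _ _ _ _ SC l0) (psi_le _ _ _ _ SC l0)
    (one_le_weights _ _ _ _ SC l0 l1).
  have e : (sin y - b) * chi l b y = l ^+ 2 * ((sin y - b) ^+ 2 / ((sin y - b) ^+ 2 + l ^+ 2 * (cos y ^+ 2 + l ^+ 2))).
    by rewrite /chi; ring.
  move=> /(_ e) /=; rewrite -/cM F1E F2E /k1 /k2 /k3 => /le_trans; apply.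
  by rewrite !mul0r !add0r !mul1r.
clear - h cM0; clearbody cM I.
have : 2 / 5 <= (5 * cM ^+ 2)^-1 * I by lra.
by rewrite ler_pdivlMl ?mulr_gt0 ?exprn_gt0 ?ltr0n//; lra.
Qed.

End resolvent.

(** * Complex-valued functions and the pseudospectral bound *)

Section complex_part.
Context {R : realType}.
Notation mu := (@lebesgue_measure R).
Implicit Types (f g h : R -> R[i]).
Local Notation T := (@torus R).
Local Notation L := (pi *+ 2 : R).
Local Open Scope complex_scope.
Local Notation Re := (@complex.Re _).
Local Notation Im := (@complex.Im _).

Lemma normc_sqr (z : R[i]) : Normc.normc z ^+ 2 = Re z ^+ 2 + Im z ^+ 2.
Proof. by case: z => x y /=; rewrite sqr_sqrtr// addr_ge0 ?sqr_ge0. Qed.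

Lemma L2_sqint f : L2 f -> sqint (fun y => Re (f y)) /\ sqint (fun y => Im (f y)).
Proof.
move=> [_ mRe mIm iN].
have mr (u : R -> R) : measurable_fun setT u -> measurable_fun T (fun y => (u y ^+ 2)%:E).
  move=> mu'; apply/measurable_EFinP; apply: measurable_funX.
  exact: (@measurable_funS _ _ _ _ setT).
split; split => //.
- apply: (le_integrable measurable_torus (mr _ mRe) _ iN) => y _.
  rewrite normc_sqr /= lee_fin !ger0_norm ?lerDl ?addr_ge0 ?sqr_ge0//.
- apply: (le_integrable measurable_torus (mr _ mIm) _ iN) => y _.
  rewrite normc_sqr /= lee_fin !ger0_norm ?lerDr ?addr_ge0 ?sqr_ge0//.
Qed.

Lemma Re_mul_real (z : R[i]) (x : R) : Re (z * x%:C) = Re z * x.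
Proof. by case: z => u v /=; rewrite mulr0 subr0. Qed.

Lemma Im_mul_real (z : R[i]) (x : R) : Im (z * x%:C) = Im z * x.
Proof. by case: z => u v /=; rewrite mulr0 add0r. Qed.

Lemma weak_derivative_parts f g : is_weak_derivative f g ->
  rweak (fun y => Re (f y)) (fun y => Re (g y)) /\
  rweak (fun y => Im (f y)) (fun y => Im (g y)).
Proof.
move=> fg; split=> phi tphi.
- have /= := congr1 Re (fg _ tphi).
  under eq_Rintegral do rewrite Re_mul_real.
  by under [X in _ = - X -> _]eq_Rintegral do rewrite Re_mul_real.
- have /= := congr1 Im (fg _ tphi).
  under eq_Rintegral do rewrite Im_mul_real.
  by under [X in _ = - X -> _]eq_Rintegral do rewrite Im_mul_real.
Qed.

Lemma weak_derivativeP f : (exists g, L2 g /\ is_weak_derivative f g) ->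
  L2 (weak_derivative f) /\ is_weak_derivative f (weak_derivative f).
Proof. by move=> [g hg]; rewrite /weak_derivative; case: xgetP => [w _ hw|/(_ g)]. Qed.

(** The chosen first derivative need not be the one whose weak derivative is
    given, but derivatives of test functions are test functions, so the two have
    the same weak derivatives. *)
Lemma H2_derivatives f : H2 f ->
  let g := weak_derivative f in let h := weak_derivative g in
  [/\ L2 f, L2 g, L2 h, is_weak_derivative f g & is_weak_derivative g h].
Proof.
move=> [Lf [g0 [h0 [Lg0 Lh0 fg0 gh0]]]] g h.
have [Lg fg] : L2 g /\ is_weak_derivative f g by apply: weak_derivativeP; exists g0.
have gh : is_weak_derivative g h0.
  move=> phi tphi; have [_ _ tphi'] := test_deriv _ tphi.
  by rewrite -(gh0 _ tphi); apply: oppr_inj; rewrite -(fg _ tphi') -(fg0 _ tphi').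
by have [Lh gh'] : L2 h /\ is_weak_derivative g h by apply: weak_derivativeP; exists h0.
Qed.

Lemma Hprime_parts (kf nu gamma lambda : R) (k1 k3 : int) f (y : R) :
  0 < kf -> 0 < nu ->
  let a := k1%:~R * gamma / (kf ^+ 2 * nu) in
  let h := weak_derivative (weak_derivative f) in
  let F := Hprime kf nu gamma k1 k3 f y - 'i * lambda%:C * f y in
  Re F = - (nu * kf ^+ 2) * Re (h y) - (a * sin y - lambda) * Im (f y) /\
  Im F = - (nu * kf ^+ 2) * Im (h y) + (a * sin y - lambda) * Re (f y).
Proof.
move=> kf0 nu0 a h F.
have E : F = - (nu * kf ^+ 2)%:C * h y + 'i * (a * sin y - lambda)%:C * f y.
  rewrite /F /Hprime -/h rmorphB mulrBr mulrBl addrA; congr (_ + _ - _).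
  congr (_ * _); rewrite -!mulrA; congr (_ * _).
  rewrite -fmorphV -(rmorph_int (real_complex R)) -!rmorphM; congr (_%:C).
  by rewrite /a; field; rewrite !gt_eqF.
rewrite E; case: (f y) => f1 f2; case: (h y) => h1 h2 /=; split; ring.
Qed.

Lemma sqint_opp (u : R -> R) : sqint u -> sqint (fun y => - u y).
Proof.
move=> /(sqint_mul_continuous _ (fun=> -1) (fun x => cvg_cst _)).
by congr sqint; apply/funext => y; rewrite mulN1r.
Qed.

Lemma rweak_opp (u v : R -> R) : sqint u -> sqint v -> rweak u v ->
  rweak (fun y => - u y) (fun y => - v y).
Proof.
move=> su sv uv phi tphi.
have opp (w z : R -> R) : continuous z -> sqint w ->
    \int[mu]_(y in T) (- w y * z y) = - \int[mu]_(y in T) (w y * z y).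
  move=> cz sw; under eq_Rintegral do rewrite mulNr -mulN1r.
  rewrite RintegralZl ?mulN1r//.
  by apply: integrable_mul_continuous => //; exact: sqint_integrable.
have [_ cphi tphi'] := test_deriv _ tphi; have [_ cphi' _] := test_deriv _ tphi'.
by rewrite !opp// uv.
Qed.

Lemma L2norm_sqr f : L2norm f = Num.sqrt (\int[mu]_(y in T) (Re (f y) ^+ 2 + Im (f y) ^+ 2)).
Proof. by congr Num.sqrt; apply: eq_Rintegral => y _; rewrite normc_sqr. Qed.

(** With [eps = nu kf ^ 2] and [a = k1 gamma / (kf ^ 2 nu)], the product [eps |a|]
    is [|k1 gamma|]; for [k1 <> 0] the hypothesis [nu ^ 2 <= gamma] ensures
    [eps <= |a|], that is [l <= 1]. *)
Lemma resolvent_bound (kf nu gamma lambda : R) (k1 k3 : int) f :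
  0 < kf -> kf <= 1 -> 0 < nu -> nu ^+ 2 <= gamma -> H2 f -> L2norm f = 1 ->
  500^-1 ^+ 2 * Num.sqrt `|k1%:~R * gamma| <=
  L2norm (fun y => Hprime kf nu gamma k1 k3 f y - 'i * lambda%:C * f y).
Proof.
move=> kf0 kf1 nu0 gam /H2_derivatives [].
set g := weak_derivative f; set h := weak_derivative g => Lf Lg Lh fg gh.
have [->|k10] := eqVneq k1 0; first by rewrite mul0r normr0 sqrtr0 mulr0 sqrtr_ge0.
rewrite !L2norm_sqr => n1.
have gam0 : 0 < gamma by rewrite (lt_le_trans _ gam)// exprn_gt0.
pose a := k1%:~R * gamma / (kf ^+ 2 * nu); pose e := nu * kf ^+ 2.
have kf20 : 0 < kf ^+ 2 by rewrite exprn_gt0.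
have e0 : 0 < e by rewrite mulr_gt0.
have d0 : 0 < kf ^+ 2 * nu by rewrite mulr_gt0.
have k1R : (k1%:~R : R) != 0 by rewrite intr_eq0.
have aN0 : a != 0 by rewrite /a mulf_neq0 ?mulf_neq0 ?invr_neq0 ?(gt_eqF gam0) ?(gt_eqF d0).
have a0 : 0 < `|a| by rewrite normr_gt0.
have aE : `|a| = `|k1%:~R * gamma| / (kf ^+ 2 * nu) by rewrite normrM normfV (gtr0_norm d0).
have ea : e <= `|a|.
  rewrite aE ler_pdivlMr// normrM (gtr0_norm gam0).
  have k1n : 1 <= `|k1%:~R : R|.
    by rewrite -intr_norm (_ : 1 = 1%:~R)// ler_int -gtz0_ge1 normr_gt0.
  have kf21 : kf ^+ 2 <= 1 by rewrite expr_le1 ?(ltW kf0).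
  have h1 : e * (kf ^+ 2 * nu) <= nu ^+ 2.
    rewrite /e (_ : _ * _ = nu ^+ 2 * (kf ^+ 2 * kf ^+ 2)); last by ring.
    rewrite ler_piMr ?sqr_ge0// mulr_ile1// ltW//.
  apply: le_trans h1 _; apply: le_trans gam _.
  by rewrite ler_peMl// ltW.
pose l := Num.sqrt (Num.sqrt (e / `|a|)).
have r0 : 0 < e / `|a| by rewrite divr_gt0.
have l0 : 0 < l by rewrite !sqrtr_gt0.
have l2 : l ^+ 2 = Num.sqrt (e / `|a|) by rewrite sqr_sqrtr ?sqrtr_ge0.
have l4 : l ^+ 4 = e / `|a|.
  by rewrite (exprM l 2 2) l2 sqr_sqrtr// ltW.
have l1 : l <= 1.
  rewrite -(@expr_le1 _ 4) ?(ltW l0)// l4 ler_pdivrMr// mul1r//.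
have al4 : `|a| * l ^+ 4 = e by rewrite l4 mulrC divfK ?gt_eqF.
have al2 : (`|a| * l ^+ 2) ^+ 2 = `|k1%:~R * gamma|.
  rewrite exprMn -exprM expr2 -mulrA al4 aE /e; field.
  by rewrite !gt_eqF.
have [sf1 sf2] := L2_sqint _ Lf; have [sg1 sg2] := L2_sqint _ Lg.
have [sh1 sh2] := L2_sqint _ Lh.
have [fg1 fg2] := weak_derivative_parts _ _ fg.
have [gh1 gh2] := weak_derivative_parts _ _ gh.
set N := Rintegral _ _ _ in n1; have {}n1 : N = 1.
  by have := congr1 (fun x => x ^+ 2) n1; rewrite /= sqr_sqrtr ?expr1n//;
    apply: Rintegral_ge0 => y _; rewrite addr_ge0 ?sqr_ge0.
set I := Rintegral _ _ _.
suff hI : 2 * (500^-1 ^+ 2 * (`|a| * l ^+ 2)) ^+ 2 <= I.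
  have M0 : 0 <= `|a| * l ^+ 2 by rewrite mulr_ge0 ?sqr_ge0.
  rewrite -al2 sqrtr_sqr (ger0_norm M0).
  have c0 : (0 : R) <= 500^-1 ^+ 2 by apply: exprn_ge0; rewrite invr_ge0 ler0n.
  have X0 := mulr_ge0 c0 M0; move: hI X0.
  set X := (500^-1 ^+ 2 * _) => hI X0.
  rewrite -(ger0_norm X0) -sqrtr_sqr ler_wsqrtr//.
  by apply: le_trans hI; rewrite ler_peMl ?sqr_ge0// ler1n.
have P y := Hprime_parts kf nu gamma lambda k1 k3 f y kf0 nu0.
have [apos|aneg] : (0 < a) + (a < 0) by case: (ltgtP a 0) aN0 => //; [right|left].
- apply: (real_resolvent `|a| (lambda / a) l _ _ _ _ _ _ _ _ a0 l0 l1
    sf1 sf2 sg1 sg2 sh1 sh2 fg1 fg2 gh1 gh2 n1) => y.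
    rewrite al4; have [-> _] := P y; rewrite -/a -/e (gtr0_norm apos).
    by field.
  rewrite al4; have [_ ->] := P y; rewrite -/a -/e (gtr0_norm apos).
  by field.
(* A negative drift is reduced to a positive one by complex conjugation. *)
have nN : \int[mu]_(y in T) (Re (f y) ^+ 2 + (- Im (f y)) ^+ 2) = 1.
  by rewrite -n1; apply: eq_Rintegral => y _; rewrite sqrrN.
have := real_resolvent `|a| (lambda / a) l _ _ _ _ _ _
  (fun y => Re (Hprime kf nu gamma k1 k3 f y - 'i * lambda%:C * f y))
  (fun y => - Im (Hprime kf nu gamma k1 k3 f y - 'i * lambda%:C * f y)) a0 l0 l1
  sf1 (sqint_opp _ sf2) sg1 (sqint_opp _ sg2) sh1 (sqint_opp _ sh2)
  fg1 (rweak_opp _ _ sf2 sg2 fg2) gh1 (rweak_opp _ _ sg2 sh2 gh2) nN.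
rewrite al4 (ltr0_norm aneg) => H.
rewrite (_ : I = \int[mu]_(y in T) (Re (Hprime kf nu gamma k1 k3 f y - 'i * lambda%:C * f y) ^+ 2 +
   (- Im (Hprime kf nu gamma k1 k3 f y - 'i * lambda%:C * f y)) ^+ 2)); last first.
  by apply: eq_Rintegral => y _; rewrite sqrrN.
apply: H => y.
  by have [-> _] := P y; rewrite -/a -/e; field.
by have [_ ->] := P y; rewrite -/a -/e; field.
Qed.

Lemma L2_cst (c : R) : L2 (fun=> c%:C).
Proof.
split=> //; try exact: measurable_cst.
exact: integrable_torus_cst.
Qed.

Lemma Rintegral_test_deriv (phi : R -> R) : test_function phi ->
  \int[mu]_(y in T) derive1 phi y = 0.
Proof.
move=> tphi; have [dphi cphi tphi'] := test_deriv _ tphi.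
have [_ cphi' _] := test_deriv _ tphi'; have [pphi _] := tphi.
have [_ /(_ L)] := primitive_C1 _ _ _ (@period_gt0 R) dphi cphi'.
rewrite lexx (ltW period_gt0) => /(_ isT).
by rewrite -{1}(add0r L) pphi => /eqP; rewrite -subr_eq0 opprD addrA subrr add0r oppr_eq0 => /eqP.
Qed.

Lemma weak_derivative_cst (c : R) : is_weak_derivative (fun=> c%:C) (fun=> 0%:C).
Proof.
move=> phi tphi; rewrite /torus_integral.
have [dphi cphi tphi'] := test_deriv _ tphi; have [_ cphi' _] := test_deriv _ tphi'.
have z (u : R -> R) : (forall y, u y = 0) -> \int[mu]_(y in T) u y = 0.
  move=> u0; rewrite (_ : u = fun=> 0); last exact/funext.
  by rewrite Rintegral_torus_cst mul0r.
rewrite [X in _ = - (X +i* _)]z; last by move=> y; rewrite Re_mul_real mul0r.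
rewrite [X in _ = - (_ +i* X)]z; last by move=> y; rewrite Im_mul_real mul0r.
rewrite [X in _ +i* X = _]z; last by move=> y; rewrite Im_mul_real mul0r.
under eq_Rintegral do rewrite Re_mul_real.
rewrite RintegralZl//; last exact: continuous_integrable_itv.
by rewrite Rintegral_test_deriv// mulr0 /= oppr0.
Qed.

(** The infimum of an empty set is [0], so the set that defines [Psi] must be shown
    to be nonempty. *)
Lemma H2_unit : exists2 f : R -> R[i], H2 f & L2norm f = 1.
Proof.
exists (fun=> (Num.sqrt (L^-1))%:C).
  split; first exact: L2_cst.
  exists (fun=> 0%:C), (fun=> 0%:C).
  by split; [exact: L2_cst|exact: L2_cst|exact: weak_derivative_cst|exact: weak_derivative_cst].
have L0 := @period_gt0 R.
rewrite L2norm_sqr /= expr0n addr0 Rintegral_torus_cst sqr_sqrtr ?invr_ge0 ?(ltW L0)//.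
by rewrite mulVf ?sqrtr1// gt_eqF.
Qed.

End complex_part.

Theorem lemma4p1 (R : realType) (kf : R) (hkf0 : 0 < kf) (hkf1 : kf <= 1) :
  exists K c : R, [/\ 0 < K, 0 < c &
    forall (nu gamma : R) (k1 k3 : int), 0 < nu -> K * nu ^+ 2 <= gamma ->
      c * Num.sqrt `|k1%:~R * gamma| <= Psi H2 (Hprime kf nu gamma k1 k3)].
Proof.
exists 1, (500^-1 ^+ 2); split; first exact: ltr01.
  by apply: exprn_gt0; rewrite invr_gt0 ltr0n.
move=> nu gamma k1 k3 nu0; rewrite mul1r => gam.
apply: lb_le_inf.
  have [f Hf nf] := @H2_unit R.
  by exists (L2norm (fun y => Hprime kf nu gamma k1 k3 f y - Complex 0 1 * real_complex R 0 * f y)), f, 0.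
by move=> _ [f [lambda [Hf nf ->]]]; exact: resolvent_bound.
Qed.
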